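(* Let $(X,T)$ be a minimal dynamical system given by a continuous map $T$ on a metrizable space $X$ and let $G$ be a compact connected metrizable abelian group. For $g\in G$ let $R_g$ denote the rotation of $G$ by $g$. Then the product $(X\times G,T\times R_g)$ is minimal for every $g$ from a residual subset of $G$ of full Haar measure. Consequently, every compact connected metrizable abelian group is homeo-product-minimal.
   Context: A dynamical system $(X,T)$ (with $X$ metrizable, not necessarily compact, and $T$ continuous) is minimal if there is no proper nonempty closed $M\subsetneq X$ with $T(M)\subseteq M$; equivalently, every forward orbit is dense. The rotation is $R_g(h)=gh$. A compact metrizable space $Y$ is homeo-product-minimal if for every minimal system $(X,T)$ with $X$ metrizable, not necessarily compact, there is a homeomorphism $S\colon Y\to Y$ such that $(X\times Y,T\times S)$ is minimal. *)

(* Defs.v *)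
From HB Require Import structures.
From mathcomp Require Import all_boot all_order all_algebra.
From mathcomp Require Import all_classical all_reals all_analysis.
From mathcomp Require Import borel_hierarchy.

Set Implicit Arguments.
Unset Strict Implicit.
Unset Printing Implicit Defensive.

Import Order.TTheory GRing.Theory Num.Theory.
Import numFieldNormedType.Exports.

Local Open Scope classical_set_scope.
Local Open Scope ring_scope.

Definition metrizable (R : realType) (X : topologicalType) : Prop :=
  exists d : X -> X -> R,
    [/\ forall x, d x x = 0,
        forall x y, d x y = 0 -> x = y,
        forall x y, d x y = d y x,
        forall x y z, d x z <= d x y + d y z
      & forall x (A : set X),
          nbhs x A <-> exists2 e, 0 < e & [set y | d x y < e] `<=` A].

Definition minimal (X : topologicalType) (T : X -> X) : Prop :=
  forall M : set X, closed M -> M !=set0 -> T @` M `<=` M -> M = [set: X].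

Definition minimal_system (R : realType) (X : topologicalType) (T : X -> X)
    : Prop :=
  [/\ metrizable R X, continuous T & minimal T].

Definition prod_fun (X Y : Type) (T : X -> X) (S : Y -> Y) (p : X * Y) : X * Y :=
  (T p.1, S p.2).

Definition homeomorphism (X Y : topologicalType) (f : X -> Y) : Prop :=
  continuous f /\ exists g : Y -> X, [/\ continuous g, cancel f g & cancel g f].

Definition homeo_product_minimal (R : realType) (Y : topologicalType) : Prop :=
  [/\ compact [set: Y], metrizable R Y
    & forall (X : topologicalType) (T : X -> X), minimal_system R T ->
      exists2 S : Y -> Y, homeomorphism S & minimal (prod_fun T S)].

(* The group law is written additively. *)
Definition rotation (G : zmodType) (g h : G) : G := g + h.

Definition residual (X : topologicalType) (A : set X) : Prop :=
  exists2 B : set X, Gdelta_dense B & B `<=` A.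

(* The library points a [zmodType] at 0; the cast to [zmodType] makes this
   pointing, required by [measurableType], available. *)
Definition borel (G : topologicalZmodType) :=
  @g_sigma_algebraType (G : zmodType) (@open G).

Definition haar_measure (R : realType) (G : topologicalZmodType)
    (mu : probability (borel G) R) : Prop :=
  forall (g : G) (A : set (borel G)),
    measurable A -> mu (rotation g @` A) = mu A.

(* A compact metrizable group has exactly one Haar probability measure, so the
   universal quantifier refers to that measure. A need not be Borel: its
   complement must lie in a Borel null set. *)
Definition full_haar_measure (R : realType) (G : topologicalZmodType)
    (A : set G) : Prop :=
  forall mu : probability (borel G) R,
    haar_measure mu -> negligible mu (~` A).

(* Main.v *)
Require Import Defs.
From mathcomp Require Import all_boot all_order all_algebra.
From mathcomp Require Import all_classical all_reals all_analysis.
From mathcomp Require Import borel_hierarchy.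
From mathcomp Require Import ring lra.

(** Let [M] be a proper nonempty closed invariant subset of [X * G] for the product
    of a minimal [T] with the rotation by [g], and fix a point [x0] of [X]. By
    compactness of [G] every fibre of [M] is nonempty, and by minimality of [T] no
    fibre is the whole of [G]. The translations that map the fibre over [x0] into
    itself form a proper closed subgroup [H], and whenever [iter n T x0] returns close
    to [x0], the multiple [g *+ n] is close to [H]
    ([return_times_near_subgroup]). So it has to be shown that for most [g] the
    multiples [g *+ n], for [n] in the unbounded set of return times to some
    neighborhood of [x0], do not cluster at a proper closed subgroup.

    The usual argument composes with a nontrivial character of [G / H], which maps
    the connected group [G] onto the circle. Here a weaker object does the same
    service: a continuous pseudonorm [q] on [G], vanishing on [H] but not
    everywhere, with the escape property
    [n * q x <= q (x *+ n) + (n * q x) ^+ 2 / 2]. By connectedness [q] takes the value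
    [1 / n] for every large [n], and at such a point [q (x *+ n) >= 1 / 2]. If [q (g *+ n)]
    is at most 1/8 for all [g] in a closed set [C] and all return times [n], then
    [q (v *+ n)] is at most 1/4 for all differences [v] of elements of [C]; hence these
    differences do not fill a neighborhood of 0
    ([small_multiples_differences]). A closed set [C] with this property has empty
    interior ([dense_differences]) and, by the argument of Steinhaus, measure 0 for
    the Haar measure ([haar_null_differences]). Countably many sets [C] suffice,
    because near [H] one may use finite unions of balls from a countable base.

    The pseudonorm is built in [escape_pseudonorm], from an invariant pseudonorm
    [psi] vanishing exactly on [H]. Finite averages of translates define an
    invariant mean. Convolution by [k = psi - mean psi] is a self-adjoint operator
    [T]. The size of [T^(2m+2) f], divided by its largest possible order of
    magnitude [energy m], is asymptotically a translation-invariant seminorm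
    [growth] in [f]. Since [T] smooths and can be undone at bounded cost as far as
    [growth] is concerned, translations act on functions continuously in the
    operator norm for [growth] ([growth_smooth]). The pseudonorm [q x] is
    the operator norm of the translation by [x] minus the identity; its escape
    property is a second-order expansion ([escapeP]), and it is not identically 0
    because [k] has mean 0 ([escape_nontrivial]). *)

Set Implicit Arguments.
Unset Strict Implicit.
Unset Printing Implicit Defensive.

Import Order.TTheory GRing.Theory Num.Theory.
Import numFieldNormedType.Exports.

Local Open Scope classical_set_scope.
Local Open Scope ring_scope.

Section Averages.
Variables (R : realType) (G : zmodType).
Implicit Types (f g h : G -> R) (s t : seq G) (x y a d : G) (b c e : R).

Definition avg s f x : R := (\sum_(a <- s) f (x + a)) / (size s)%:R.

Definition sumset s t : seq G := [seq a + d | a <- s, d <- t].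

Lemma sumset_neq0 s t : s != [::] -> t != [::] -> sumset s t != [::].
Proof. by case: s => // a s; case: t. Qed.

Lemma size_unit s : s != [::] -> (size s)%:R != 0 :> R.
Proof. by rewrite pnatr_eq0 size_eq0. Qed.

Lemma avg_sumset s t f x : avg (sumset s t) f x = avg s (avg t f) x.
Proof.
rewrite /avg /sumset big_allpairs_dep /= size_allpairs natrM invfM mulrCA mulrA.
rewrite -mulr_suml (mulrC (size s)%:R^-1) [LHS]mulrAC; congr (_ / _ / _).
by apply: eq_bigr => a _; apply: eq_bigr => b _; rewrite addrA.
Qed.

Lemma avgC s t f x : avg s (avg t f) x = avg t (avg s f) x.
Proof.
rewrite /avg -!mulr_suml mulrAC; congr (_ / _ / _).
rewrite exchange_big /=; apply: eq_bigr => a _; apply: eq_bigr => b _.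
by rewrite addrAC.
Qed.

Lemma avgD s f g x : avg s (fun y => f y + g y) x = avg s f x + avg s g x.
Proof. by rewrite /avg big_split /= mulrDl. Qed.

Lemma avgZ s c f x : avg s (fun y => c * f y) x = c * avg s f x.
Proof. by rewrite /avg -mulr_sumr mulrA. Qed.

Lemma avg_cst s c x : s != [::] -> avg s (fun=> c) x = c.
Proof.
move=> s0; rewrite /avg big_const_seq count_predT iter_addr_0 -[c *+ _]mulr_natr mulfK //.
exact: size_unit.
Qed.

Lemma avgB s f g x : avg s (fun y => f y - g y) x = avg s f x - avg s g x.
Proof. by rewrite /avg sumrB mulrBl. Qed.

Lemma avg_le s f g x : (forall y, f y <= g y) -> avg s f x <= avg s g x.
Proof.
move=> fg; rewrite /avg ler_wpM2r ?invr_ge0 //.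
by apply: ler_sum => a _; exact: fg.
Qed.

Lemma avg_norm s f e x : s != [::] ->
  (forall y, `|f y| <= e) -> `|avg s f x| <= e.
Proof.
move=> s0 fe; rewrite ler_norml -{1}(avg_cst (- e) x s0) -{2}(avg_cst e x s0).
by apply/andP; split; apply: avg_le => y; have := fe y; rewrite ler_norml => /andP[].
Qed.

Lemma avg_dist_in s f c e x : s != [::] ->
  (forall a, a \in s -> `|f (x + a) - c| <= e) -> `|avg s f x - c| <= e.
Proof.
move=> s0 fe; rewrite -{1}(avg_cst c x s0) -avgB /avg normrM normfV normr_nat.
rewrite ler_pdivrMr ?ltr0n ?lt0n ?size_eq0 // (le_trans (ler_norm_sum _ _ _)) //.
rewrite mulr_natr -[leRHS]iter_addr_0 -count_predT -big_const_seq.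
by rewrite !big_seq; apply: ler_sum => a /fe.
Qed.

Lemma avg_dist s f c e x : s != [::] ->
  (forall y, `|f y - c| <= e) -> `|avg s f x - c| <= e.
Proof.
move=> s0 fe; rewrite -{1}(avg_cst c x s0) -avgB; exact: avg_norm.
Qed.

Lemma avg_shift s f d x : avg s f (x + d) = avg s (fun y => f (y + d)) x.
Proof. by rewrite /avg; congr (_ / _); apply: eq_bigr => a _; rewrite addrAC. Qed.

(** The difference telescopes: only the two ends of the progression survive. *)
Lemma avg_progression f d N b x : (0 < N)%N -> (forall y, `|f y| <= b) ->
  `|avg [seq d *+ j | j <- iota 0 N] f (x + d)
    - avg [seq d *+ j | j <- iota 0 N] f x| <= 2 * b / N%:R.
Proof.
move=> N0 fb; rewrite /avg size_map size_iota -mulrBl normrM normfV normr_nat.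
rewrite ler_wpM2r ?invr_ge0 // !big_map -sumrB.
have -> : iota 0 N = index_iota 0 N by rewrite /index_iota subn0.
under eq_bigr do rewrite -addrA -mulrS.
rewrite (telescope_sumr (fun j => f (x + d *+ j))) //.
by rewrite mulr_natl mulr2n (le_trans (ler_normB _ _)) // lerD.
Qed.

(** For uniformly continuous [f] on a precompact group this is the integral of [f]
    for the normalized invariant measure. As an infimum over all finite averages
    it needs no choice of averaging sets. *)
Definition mean f : R :=
  inf [set c | exists2 s, s != [::] & forall x, avg s f x <= c].

(** Averages commute, so averaging [avg s f] further over any [t] keeps it within
    [e] of [c]; hence no average [avg t f] stays below [c - e]. *)
Lemma mean_near s f c e : s != [::] ->
  (forall x, `|avg s f x - c| <= e) -> `|mean f - c| <= e.
Proof.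
move=> s0 H; rewrite /mean; set A := (X in inf X).
have lbA : lbound A (c - e).
  move=> b [t t0 tb].
  rewrite (@le_trans _ _ (avg t (avg s f) 0)) //.
    rewrite -(avg_cst (c - e) 0 t0); apply: avg_le => y.
    by have := H y; rewrite ler_distl => /andP[].
  by rewrite avgC -(avg_cst b 0 s0); apply: avg_le.
have Ace : A (c + e).
  by exists s => // x; have := H x; rewrite ler_distl => /andP[].
rewrite ler_distl; apply/andP; split.
  by apply: lb_le_inf => //; exists (c + e).
by apply: ge_inf => //; exists (c - e).
Qed.

Opaque mean.

Lemma eq_mean f g : f =1 g -> mean f = mean g.
Proof. by move=> /funext ->. Qed.

Lemma mean_uniq f c :
  (forall e, 0 < e -> exists2 s, s != [::] & forall x, `|avg s f x - c| <= e) ->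
  mean f = c.
Proof.
move=> H; apply/eqP; rewrite -subr_eq0 -normr_le0.
apply/ler_addgt0Pl => e e0; rewrite addr0.
by have [s s0 Hs] := H e e0; exact: mean_near Hs.
Qed.

Lemma mean_cst c : mean (fun=> c) = c.
Proof.
apply: mean_uniq => e e0; exists [:: 0] => // x.
by rewrite avg_cst // subrr normr0 ltW.
Qed.

End Averages.

(** Only precompactness of the group enters from here on, through finite nets for
    [nu]; no topology is needed until the pseudonorm with the escape property is
    built. *)
Section Mean.
Variables (R : realType) (G : zmodType) (nu : G -> R).
Hypothesis nu_tb : forall e : R, 0 < e ->
  exists D : seq G, forall x, exists2 a, a \in D & nu (x - a) < e.

Implicit Types (f g h : G -> R) (s t : seq G) (x y a d : G) (b c e : R).

Definition unif_cont f :=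
  forall e, 0 < e -> exists2 r : R, 0 < r &
    forall x y, nu y < r -> `|f (x + y) - f x| <= e.

Lemma unif_cont_bounded f : unif_cont f -> exists2 b : R, 0 < b & forall x, `|f x| <= b.
Proof.
move=> /(_ 1 ltr01)[r r0 fr]; have [D HD] := nu_tb r0.
exists (1 + \sum_(a <- D) `|f a|).
  by rewrite ltr_pwDl // sumr_ge0.
move=> x; have [a aD xa] := HD x.
have := fr a _ xa; rewrite (addrC a) subrK => H.
rewrite -[f x](subrK (f a)) (le_trans (ler_normD _ _)) // lerD //.
by rewrite (big_rem a) //= lerDl sumr_ge0.
Qed.

Lemma unif_cont_cst c : unif_cont (fun=> c).
Proof. by move=> e e0; exists 1 => // x y _; rewrite subrr normr0 ltW. Qed.

Lemma unif_contD f g : unif_cont f -> unif_cont g -> unif_cont (fun x => f x + g x).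
Proof.
move=> uf ug e e0; have e2 : 0 < e / 2 by lra.
have [r r0 Hr] := uf _ e2; have [r' r'0 Hr'] := ug _ e2.
exists (Num.min r r'); first by rewrite lt_min r0.
move=> x y; rewrite lt_min => /andP[yr yr'].
rewrite opprD addrACA (le_trans (ler_normD _ _)) //.
by have := Hr x _ yr; have := Hr' x _ yr'; lra.
Qed.

Lemma unif_contM f g : unif_cont f -> unif_cont g -> unif_cont (fun x => f x * g x).
Proof.
move=> uf ug e e0.
have [b b0 fb] := unif_cont_bounded uf; have [b' b'0 gb] := unif_cont_bounded ug.
have e1 : 0 < e / 2 / b' by rewrite !divr_gt0.
have e2 : 0 < e / 2 / b by rewrite !divr_gt0.
have [r r0 Hr] := uf _ e1; have [r' r'0 Hr'] := ug _ e2.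
exists (Num.min r r'); first by rewrite lt_min r0.
move=> x y; rewrite lt_min => /andP[yr yr'].
have -> : f (x + y) * g (x + y) - f x * g x =
  (f (x + y) - f x) * g (x + y) + f x * (g (x + y) - g x).
  by rewrite mulrBl mulrBr addrA subrK.
rewrite (le_trans (ler_normD _ _)) // !normrM.
have -> : e = e / 2 / b' * b' + b * (e / 2 / b).
  by rewrite (mulrC b) !divfK ?gt_eqF // -splitr.
by rewrite lerD // ler_pM //; [exact: Hr|exact: Hr'].
Qed.

Lemma unif_contZ c f : unif_cont f -> unif_cont (fun x => c * f x).
Proof. by apply: unif_contM; exact: unif_cont_cst. Qed.

Lemma unif_contB f g : unif_cont f -> unif_cont g -> unif_cont (fun x => f x - g x).
Proof.
move=> uf ug; have := unif_contD uf (unif_contZ (-1) ug).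
by congr unif_cont; apply/funext => x; rewrite mulN1r.
Qed.

Lemma unif_cont_shift a f : unif_cont f -> unif_cont (fun x => f (x + a)).
Proof.
move=> uf e /uf[r r0 Hr]; exists r => // x y yr.
by rewrite addrAC; exact: Hr.
Qed.

Lemma unif_cont_sum (I : Type) (s : seq I) (F : I -> G -> R) :
  (forall i, unif_cont (F i)) -> unif_cont (fun x => \sum_(i <- s) F i x).
Proof.
move=> uF; elim: s => [|i s IHs].
  have := unif_cont_cst 0; congr unif_cont; apply/funext => x.
  by rewrite big_nil.
have := unif_contD (uF i) IHs; congr unif_cont; apply/funext => x.
by rewrite big_cons.
Qed.

(** Take the sumset of long progressions whose steps run through a finite net:
    averages over it are almost invariant under each step, hence under all
    translations. The same finite set serves all functions with a common bound
    and a common modulus of continuity. *)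
Lemma avg_almost_cst r b e : 0 < r -> 0 < e -> exists2 s, s != [::] &
  forall f, (forall x, `|f x| <= b) ->
    (forall x y, nu y < r -> `|f (x + y) - f x| <= e) ->
  forall x y, `|avg s f x - avg s f y| <= 2 * e.
Proof.
move=> r0 e0; have [D HD] := nu_tb r0.
set N := (Num.truncn (2 * b / e)).+1.
have Ne : 2 * b / N%:R <= e.
  rewrite ler_pdivrMr ?ltr0n // (mulrC e) -ler_pdivrMr //.
  by apply: ltW; exact: truncnS_gt.
have N0 : (0 < N)%N by [].
clearbody N.
pose s := foldr (fun d t => sumset [seq d *+ j | j <- iota 0 N] t) [:: 0] D.
have s0 : s != [::].
  by rewrite /s; elim: (D) => // d D' IH; apply: sumset_neq0 => //; case: (N) N0.
exists s => // f fb fr.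
have step d x : d \in D -> `|avg s f (x + d) - avg s f x| <= e.
  move=> dD; apply: le_trans Ne; rewrite /s.
  elim: (D) dD x => // d' D' IH; rewrite inE => + x /=.
  set t := foldr _ _ _ in IH *.
  have t0 : t != [::].
    by rewrite /t; elim: (D') => // d1 D1 IH1; apply: sumset_neq0 => //; case: (N) N0.
  case/orP => [/eqP->|/IH dD'].
    rewrite !avg_sumset; apply: avg_progression => // y.
    exact: avg_norm.
  rewrite !avg_sumset avg_shift -avgB; apply: avg_norm => [|y].
    by case: (N) N0.
  exact: dD'.
move=> x y; have [d dD yd] := HD (x - y).
have -> : x = y + d + (x - y - d).
  by rewrite addrACA subrr addr0 addrC subrK.
rewrite -[leLHS](_ : `|(avg s f (y + d + (x - y - d)) - avg s f (y + d))
  + (avg s f (y + d) - avg s f y)| = _); last by rewrite addrA subrK.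
rewrite (le_trans (ler_normD _ _)) // mulr_natl mulr2n lerD //; last exact: step.
rewrite avg_shift -avgB; apply: avg_norm => // z.
exact: fr.
Qed.

Lemma avg_near_mean r b e : 0 < r -> 0 < e -> exists2 s, s != [::] &
  forall f, (forall x, `|f x| <= b) ->
    (forall x y, nu y < r -> `|f (x + y) - f x| <= e) ->
  forall x, `|avg s f x - mean f| <= 4 * e.
Proof.
move=> r0 e0; have [s s0 Hs] := avg_almost_cst b r0 e0.
exists s => // f fb fr x.
have /(mean_near s0) M x' : `|avg s f x' - avg s f 0| <= 2 * e by exact: Hs.
have := Hs f fb fr x 0; rewrite distrC in M.
move: M; rewrite !ler_norml => /andP[? ?] /andP[? ?].
by apply/andP; split; lra.
Qed.

Lemma mean_approx f e : unif_cont f -> 0 < e ->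
  exists2 s, s != [::] & forall x, `|avg s f x - mean f| <= e.
Proof.
move=> uf e0; have e4 : 0 < e / 4 by lra.
have [b b0 fb] := unif_cont_bounded uf.
have [r r0 Hr] := uf _ e4.
have [s s0 Hs] := avg_near_mean b r0 e4.
by exists s => // x; apply: le_trans (Hs _ fb Hr x) _; lra.
Qed.

Lemma meanD f g : unif_cont f -> unif_cont g ->
  mean (fun x => f x + g x) = mean f + mean g.
Proof.
move=> uf ug; apply: mean_uniq => e e0; have e2 : 0 < e / 2 by lra.
have [s s0 Hs] := mean_approx uf e2; have [t t0 Ht] := mean_approx ug e2.
exists (sumset s t) => [|x]; first exact: sumset_neq0.
rewrite avgD opprD addrACA (le_trans (ler_normD _ _)) //.
rewrite [leRHS](splitr e) lerD // avg_sumset.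
  by rewrite avgC; apply: avg_dist.
by apply: avg_dist.
Qed.

Lemma meanZ c f : unif_cont f -> mean (fun x => c * f x) = c * mean f.
Proof.
move=> uf; apply: mean_uniq => e e0.
have e' : 0 < e / (1 + `|c|) by rewrite divr_gt0 // ltr_pwDl.
have [s s0 Hs] := mean_approx uf e'; exists s => // x.
rewrite avgZ -mulrBr normrM (le_trans (ler_wpM2l _ (Hs x))) //.
rewrite mulrCA; apply: ler_piMr; first exact: ltW.
by rewrite ler_pdivrMr ?ltr_pwDl // mul1r lerDr.
Qed.

Lemma meanB f g : unif_cont f -> unif_cont g ->
  mean (fun x => f x - g x) = mean f - mean g.
Proof.
move=> uf ug; rewrite -[- mean g]mulN1r -meanZ // -meanD //; last exact: unif_contZ.
by apply: eq_mean => x; rewrite mulN1r.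
Qed.

Lemma mean_shift a f : unif_cont f -> mean (fun x => f (x + a)) = mean f.
Proof.
move=> uf; apply: mean_uniq => e e0.
have [s s0 Hs] := mean_approx uf e0; exists s => // x.
by rewrite -avg_shift.
Qed.

Lemma mean_opp f : unif_cont f -> mean (fun x => f (- x)) = mean f.
Proof.
move=> uf; apply: mean_uniq => e e0.
have [s s0 Hs] := mean_approx uf e0; exists (map -%R s) => [|x].
  by case: (s) s0.
rewrite (_ : avg _ _ _ = avg s f (- x)) // /avg big_map size_map.
by congr (_ / _); apply: eq_bigr => a _; rewrite opprD opprK.
Qed.

Lemma mean_le f g : unif_cont f -> unif_cont g -> (forall x, f x <= g x) ->
  mean f <= mean g.
Proof.
move=> uf ug fg; rewrite -subr_ge0 -meanB //.
apply/ler_addgt0Pl => e e0.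
have [s s0 Hs] := mean_approx (unif_contB ug uf) e0.
have := Hs 0; rewrite ler_distl => /andP[_ H]; rewrite addrC; apply: le_trans H.
by rewrite -(avg_cst 0 0 s0); apply: avg_le => x; rewrite subr_ge0.
Qed.

Lemma mean_norm f b : unif_cont f -> (forall x, `|f x| <= b) -> `|mean f| <= b.
Proof.
move=> uf fb; rewrite ler_norml -{1}(mean_cst G (- b)) -{2}(mean_cst G b).
by apply/andP; split; apply: mean_le => //; try exact: unif_cont_cst;
  move=> x; have := fb x; rewrite ler_norml => /andP[].
Qed.

Lemma mean_sum (I : Type) (s : seq I) (F : I -> G -> R) :
  (forall i, unif_cont (F i)) ->
  mean (fun x => \sum_(i <- s) F i x) = \sum_(i <- s) mean (F i).
Proof.
move=> uF; elim: s => [|i s IHs].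
  by rewrite big_nil -[RHS](mean_cst G); apply: eq_mean => x; rewrite big_nil.
rewrite big_cons -IHs -meanD //; last exact: unif_cont_sum.
by apply: eq_mean => x; rewrite big_cons.
Qed.

(** Finitely many translates of a ball cover the group, so finitely many
    translates of [f] add up to a function bounded away from 0. *)
Lemma mean_gt0 f x0 : unif_cont f -> (forall x, 0 <= f x) -> 0 < f x0 ->
  0 < mean f.
Proof.
move=> uf f0 fx0; have c0 : 0 < f x0 / 2 by lra.
have [r r0 Hr] := uf _ c0; have [D HD] := nu_tb r0.
have H : f x0 / 2 <= mean (fun x => \sum_(a <- D) f (x + (x0 - a))).
  rewrite -(mean_cst G (f x0 / 2)); apply: mean_le.
  - exact: unif_cont_cst.
  - by apply: unif_cont_sum => a; exact: unif_cont_shift.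
  move=> x; have [a aD xa] := HD x.
  rewrite (big_rem a) //= -[leLHS]addr0 lerD ?sumr_ge0 //.
  have := Hr x0 _ xa; rewrite addrCA ler_distl => /andP[+ _].
  by apply: le_trans; lra.
rewrite mean_sum in H; last by move=> a; exact: unif_cont_shift.
have {H} : 0 < \sum_(a <- D) mean f.
  rewrite (lt_le_trans c0) // (le_trans H) // le_eqVlt; apply/orP; left.
  by apply/eqP/eq_bigr => a _; rewrite mean_shift.
rewrite big_const_seq count_predT iter_addr_0 => H.
have m0 : 0 <= mean f.
  by rewrite -(mean_cst G 0); apply: mean_le => //; exact: unif_cont_cst.
rewrite lt_neqAle m0 andbT; apply: contraTneq H => <-.
by rewrite mul0rn ltxx.
Qed.

(** Averages over a finite set commute with [mean], and one finite set averages
    all the functions [F x] at once. *)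
Lemma mean_exchange (F : G -> G -> R) b : (forall x y, `|F x y| <= b) ->
  (forall e, 0 < e -> exists2 r : R, 0 < r & forall x y u, nu u < r ->
     `|F x (y + u) - F x y| <= e /\ `|F (x + u) y - F x y| <= e) ->
  mean (fun x => mean (F x)) = mean (fun y => mean (fun x => F x y)).
Proof.
move=> Fb uF.
have uF1 x : unif_cont (F x).
  by move=> e /uF[r r0 H]; exists r => // y u /(H x y)[].
have uF2 y : unif_cont (F ^~ y).
  by move=> e /uF[r r0 H]; exists r => // x u /(H x y)[].
have uM : unif_cont (fun x => mean (F x)).
  move=> e /uF[r r0 H]; exists r => // x u ur.
  rewrite -meanB //; apply: mean_norm; first exact: unif_contB.
  by move=> y; have [] := H x y u ur.
apply/esym/mean_uniq => e e0; have e4 : 0 < e / 4 by lra.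
have [r r0 Hr] := uF _ e4; have [s s0 Hs] := avg_near_mean b r0 e4.
exists s => // y.
have us : unif_cont (fun x => avg s (F x) y).
  have := unif_contZ (size s)%:R^-1 (unif_cont_sum s (fun a => uF2 (y + a))).
  by congr unif_cont; apply/funext => x; rewrite mulrC.
have -> : avg s (fun y => mean (F ^~ y)) y = mean (fun x => avg s (F x) y).
  rewrite /avg -mean_sum // mulrC -meanZ; last exact: unif_cont_sum.
  by apply: eq_mean => x; rewrite mulrC.
rewrite -meanB //; apply: mean_norm; first exact: unif_contB.
move=> x; have -> : e = 4 * (e / 4) by lra.
by apply: Hs => // z u /(Hr x z)[].
Qed.

(** * Convolution operators *)

(** The cross-correlation of [g] and [f] for the invariant mean. For symmetric [g]
    it is the convolution of [f] by [g]. *)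
Definition corr g f x : R := mean (fun y => g y * f (x + y)).

Lemma unif_cont_shiftl x f : unif_cont f -> unif_cont (fun y => f (x + y)).
Proof.
move=> /(unif_cont_shift x); congr unif_cont; apply/funext => y.
by rewrite addrC.
Qed.

Lemma unif_cont_corr_body g f x : unif_cont g -> unif_cont f ->
  unif_cont (fun y => g y * f (x + y)).
Proof. by move=> ug uf; apply: unif_contM => //; exact: unif_cont_shiftl. Qed.

Lemma corrB g f h x : unif_cont g -> unif_cont f -> unif_cont h ->
  corr g (fun y => f y - h y) x = corr g f x - corr g h x.
Proof.
move=> ug uf uh; rewrite /corr -meanB; first last.
- exact: unif_cont_corr_body.
- exact: unif_cont_corr_body.
by apply: eq_mean => y; rewrite mulrBr.
Qed.

Lemma corrZ g c f x : unif_cont g -> unif_cont f ->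
  corr g (fun y => c * f y) x = c * corr g f x.
Proof.
move=> ug uf; rewrite /corr -meanZ; last exact: unif_cont_corr_body.
by apply: eq_mean => y; rewrite mulrCA.
Qed.

Lemma corr_shift g f a x : corr g (fun y => f (y + a)) x = corr g f (x + a).
Proof. by apply: eq_mean => y; rewrite addrAC. Qed.

Lemma corr_norm g f b c x : unif_cont g -> unif_cont f ->
  (forall y, `|g y| <= b) -> (forall y, `|f y| <= c) -> `|corr g f x| <= b * c.
Proof.
move=> ug uf gb fc; apply: mean_norm; first exact: unif_cont_corr_body.
by move=> y; rewrite normrM ler_pM.
Qed.

Lemma unif_cont_corr g f : unif_cont g -> unif_cont f -> unif_cont (corr g f).
Proof.
move=> ug uf e e0; have [b b0 gb] := unif_cont_bounded ug.
have eb : 0 < e / b by rewrite divr_gt0.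
have [r r0 Hr] := uf _ eb; exists r => // x u ur.
rewrite -corr_shift -corrB //; last exact: unif_cont_shift.
rewrite -[leRHS](divfK (lt0r_neq0 b0)) mulrC.
apply: corr_norm => //; last by move=> y; exact: Hr.
by apply: unif_contB => //; exact: unif_cont_shift.
Qed.

Lemma corr_exchange g f h : unif_cont g -> unif_cont f -> unif_cont h ->
  mean (fun x => corr g f x * h x) = mean (fun y => g y * corr h f y).
Proof.
move=> ug uf uh.
have [b b0 gb] := unif_cont_bounded ug.
have [c c0 fc] := unif_cont_bounded uf.
have [d d0 hd] := unif_cont_bounded uh.
transitivity (mean (fun x => mean (fun y => h x * (g y * f (x + y))))).
  apply: eq_mean => x; rewrite mulrC -meanZ //.
  exact: unif_cont_corr_body.
transitivity (mean (fun y => mean (fun x => h x * (g y * f (x + y))))); last first.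
  apply: eq_mean => y; rewrite -meanZ; last exact: unif_cont_corr_body.
  by apply: eq_mean => x; rewrite mulrCA (addrC x).
apply: (mean_exchange (b := d * (b * c))).
  by move=> x y; rewrite !normrM !ler_pM // mulr_ge0.
move=> e e0; have e2 : 0 < e / 2 by lra.
have ef : 0 < e / 2 / (d * b) by rewrite divr_gt0 // mulr_gt0.
have eg : 0 < e / 2 / (d * c) by rewrite divr_gt0 // mulr_gt0.
have eh : 0 < e / 2 / (b * c) by rewrite divr_gt0 // mulr_gt0.
have [rf rf0 Hf] := uf _ ef; have [rg rg0 Hg] := ug _ eg.
have [rh rh0 Hh] := uh _ eh.
exists (Num.min rf (Num.min rg rh)); first by rewrite !lt_min rf0 rg0.
move=> x y u; rewrite !lt_min => /and3P[uf' ug' uh']; split.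
  have -> : h x * (g (y + u) * f (x + (y + u))) - h x * (g y * f (x + y)) =
    h x * ((g (y + u) - g y) * f (x + (y + u)))
    + h x * (g y * (f (x + y + u) - f (x + y))).
    by rewrite (addrA x y u); ring.
  rewrite (le_trans (ler_normD _ _)) // !normrM.
  have -> : e = d * (e / 2 / (d * c) * c) + d * (b * (e / 2 / (d * b))).
    have ? := gt_eqF d0; have ? := gt_eqF c0; have ? := gt_eqF b0.
    by field; apply/and3P; split; apply/negbT.
  by rewrite lerD // !ler_pM ?mulr_ge0 //; [exact: Hg|exact: Hf].
have -> : h (x + u) * (g y * f (x + u + y)) - h x * (g y * f (x + y)) =
    (h (x + u) - h x) * (g y * f (x + u + y))
    + h x * (g y * (f (x + y + u) - f (x + y))).
  by rewrite (addrAC x u y); ring.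
rewrite (le_trans (ler_normD _ _)) // !normrM.
have -> : e = e / 2 / (b * c) * (b * c) + d * (b * (e / 2 / (d * b))).
  have ? := gt_eqF d0; have ? := gt_eqF c0; have ? := gt_eqF b0.
  by field; apply/and3P; split; apply/negbT.
by rewrite lerD // !ler_pM ?mulr_ge0 //; [exact: Hh|exact: Hf].
Qed.

Lemma corrN g f x : unif_cont g -> unif_cont f -> corr g f (- x) = corr f g x.
Proof.
move=> ug uf; rewrite /corr -(mean_shift x); last exact: unif_cont_corr_body.
by apply: eq_mean => y; rewrite mulrC (addrC y x) addKr.
Qed.

(** Exchange the two means and replace [y] by [- y], which does not change [k y]. *)
Lemma corr_adjoint k f g : unif_cont k -> unif_cont f -> unif_cont g ->
  (forall x, k (- x) = k x) ->
  mean (fun x => corr k f x * g x) = mean (fun x => f x * corr k g x).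
Proof.
move=> uk uf ug kN; rewrite corr_exchange //.
have uM : unif_cont (fun y => k y * corr g f y).
  by apply: unif_contM => //; exact: unif_cont_corr.
rewrite -(mean_opp uM).
rewrite -[RHS](eq_mean (f := fun x => corr k g x * f x)); last first.
  by move=> x; rewrite mulrC.
by rewrite corr_exchange //; apply: eq_mean => y; rewrite kN corrN.
Qed.

Lemma cauchy_schwarz f g : unif_cont f -> unif_cont g ->
  mean (fun x => f x * g x) ^+ 2 <=
  mean (fun x => f x ^+ 2) * mean (fun x => g x ^+ 2).
Proof.
move=> uf ug.
have uff : unif_cont (fun x => f x ^+ 2) by exact: unif_contM.
have ugg : unif_cont (fun x => g x ^+ 2) by exact: unif_contM.
have ufg : unif_cont (fun x => f x * g x) by exact: unif_contM.
have [g0|/existsNP[x gx]] := pselect (forall x, g x = 0).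
  rewrite (_ : (fun x => f x * g x) = fun=> 0).
    rewrite mean_cst expr0n /= mulr_ge0 // -(mean_cst G 0);
      apply: mean_le => //; try exact: unif_cont_cst;
      by move=> x; rewrite sqr_ge0.
  by apply/funext => x; rewrite g0 mulr0.
set A := mean (fun x => f x ^+ 2); set B := mean (fun x => g x ^+ 2).
set C := mean _.
have B0 : 0 < B.
  apply: (mean_gt0 (x0 := x)) => //; first by move=> y; rewrite sqr_ge0.
  by rewrite lt_neqAle sqr_ge0 andbT eq_sym sqrf_eq0; apply/eqP.
have : 0 <= mean (fun x => B ^+ 2 * f x ^+ 2 - 2 * B * C * (f x * g x)
                           + C ^+ 2 * g x ^+ 2).
  rewrite -[leLHS](mean_cst G); apply: mean_le.
  - exact: unif_cont_cst.
  - by apply: unif_contD; last exact: unif_contZ;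
      apply: unif_contB; exact: unif_contZ.
  move=> y; rewrite (_ : _ + _ = (B * f y - C * g y) ^+ 2) ?sqr_ge0 //.
  by ring.
rewrite meanD; first last.
- exact: unif_contZ.
- by apply: unif_contB; exact: unif_contZ.
rewrite meanB //; try exact: unif_contZ.
rewrite !meanZ // -/A -/B -/C => H.
rewrite -subr_ge0 -(pmulr_rge0 _ B0).
by apply: le_trans H _; rewrite le_eqVlt; apply/orP; left; apply/eqP; ring.
Qed.


(** * Growth of functions under the powers of a convolution operator *)

Section Gleason.
Variables (k : G -> R) (psi : G -> R).
Hypothesis uk : unif_cont k.
Hypothesis kN : forall x, k (- x) = k x.
Hypothesis k_mean : mean k = 0.
Hypothesis k_neq0 : exists x, k x != 0.
Hypothesis k_psi : forall x y, `|k (y + x) - k y| <= psi x.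

Local Notation T := (corr k).
Local Notation "T^ n" := (iter n T) (at level 8, n at level 2, format "T^ n").

Lemma unif_cont_iter n f : unif_cont f -> unif_cont (T^n f).
Proof. by move=> uf; elim: n => // n IH; exact: unif_cont_corr. Qed.

Lemma iterB n f g x : unif_cont f -> unif_cont g ->
  T^n (fun y => f y - g y) x = T^n f x - T^n g x.
Proof.
move=> uf ug; elim: n x => //= n IH x.
rewrite (funext IH : T^n _ = fun y => T^n f y - T^n g y).
by apply: corrB => //; exact: unif_cont_iter.
Qed.

Lemma iterZ n c f x : unif_cont f -> T^n (fun y => c * f y) x = c * T^n f x.
Proof.
move=> uf; elim: n x => //= n IH x.
rewrite (funext IH : T^n _ = fun y => c * T^n f y).
by apply: corrZ => //; exact: unif_cont_iter.
Qed.

Lemma iter_shift n a f x : T^n (fun y => f (y + a)) x = T^n f (x + a).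
Proof.
elim: n x => //= n IH x.
by rewrite (funext IH : T^n _ = fun y => T^n f (y + a)) corr_shift.
Qed.

Lemma iter_adjoint n f g : unif_cont f -> unif_cont g ->
  mean (fun x => T^n f x * g x) = mean (fun x => f x * T^n g x).
Proof.
move=> uf ug; elim: n g ug => // n IH g ug.
rewrite /= corr_adjoint //; last exact: unif_cont_iter.
rewrite IH; last exact: unif_cont_corr.
by apply: eq_mean => x; rewrite -iterS iterSr.
Qed.

(** Bounds on [T^n k] are therefore bounds on the operator [T^n.+1]. *)
Lemma iter_kernel n f : unif_cont f -> T^n.+1 f = corr (T^n k) f.
Proof.
move=> uf; apply/funext => x.
have -> : T^n.+1 f x = T^n.+1 (fun y => f (y + x)) 0.
  by rewrite iter_shift add0r.
rewrite iterS /corr.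
have us : unif_cont (fun y => f (y + x)) by exact: unif_cont_shift.
transitivity (mean (fun y => k y * T^n (fun y => f (y + x)) y)).
  by apply: eq_mean => y; rewrite add0r.
by rewrite -iter_adjoint //; apply: eq_mean => y; rewrite (addrC x).
Qed.

Lemma iter_mean n f : unif_cont f -> mean (T^n.+1 f) = 0.
Proof.
move=> uf; have u1 : unif_cont (fun=> 1) by exact: unif_cont_cst.
transitivity (mean (fun x => T (T^n f) x * 1)).
  by apply: eq_mean => x; rewrite mulr1.
rewrite corr_adjoint //; last exact: unif_cont_iter.
rewrite -[RHS](mean_cst G); apply: eq_mean => x; rewrite /corr.
rewrite (@eq_mean _ _ _ k) ?k_mean ?mulr0 // => y.
by rewrite mulr1.
Qed.

(** This normalizes the powers of [T], being the value at 0, hence the supremum, of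
    the kernel of [T^(2m+2)]. *)
Definition energy m : R := mean (fun x => T^m k x ^+ 2).

Lemma unif_cont_sqr f : unif_cont f -> unif_cont (fun x => f x ^+ 2).
Proof. by move=> uf; exact: unif_contM. Qed.

Lemma mean_sqr_gt0 f x : unif_cont f -> f x != 0 -> 0 < mean (fun x => f x ^+ 2).
Proof.
move=> uf fx; apply: (mean_gt0 (x0 := x)).
- exact: unif_cont_sqr.
- by move=> y; rewrite sqr_ge0.
by rewrite lt_neqAle sqr_ge0 andbT eq_sym sqrf_eq0.
Qed.

Lemma iter_at0 n : T^n.+1 k 0 = mean (fun x => k x * T^n k x).
Proof. by rewrite iterS /corr; apply: eq_mean => x; rewrite add0r. Qed.

Lemma energy_at0 m : T^m.*2.+1 k 0 = energy m.
Proof.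
by rewrite iter_at0 -addnn iterD -iter_adjoint //; exact: unif_cont_iter.
Qed.

Lemma energy_logconvex m : energy m.+1 ^+ 2 <= energy m * energy m.+2.
Proof.
rewrite [X in X ^+ 2](_ : _ = mean (fun x => T^m k x * T^m.+2 k x)).
  by apply: cauchy_schwarz; exact: unif_cont_iter.
exact: (corr_adjoint uk (unif_cont_iter m uk) (unif_cont_iter m.+1 uk) kN).
Qed.

Definition ratio : R := energy 1 / energy 0.

Lemma energy0_gt0 : 0 < energy 0.
Proof. by have [x kx] := k_neq0; exact: mean_sqr_gt0 kx. Qed.

Lemma energy1_gt0 : 0 < energy 1.
Proof.
apply: (mean_sqr_gt0 (x := 0)); first exact: unif_cont_iter.
by rewrite (energy_at0 0) gt_eqF // energy0_gt0.
Qed.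

Lemma ratio_gt0 : 0 < ratio.
Proof. by rewrite divr_gt0 ?energy0_gt0 ?energy1_gt0. Qed.

(** By log-convexity the successive quotients of [energy] do not decrease, so the
    first one bounds them all from below. This is where self-adjointness prevents
    the powers of [T] from vanishing at a superexponential rate. *)
Lemma energy_growth m : 0 < energy m /\ ratio * energy m <= energy m.+1.
Proof.
elim: m => [|m [e0 IH]].
  by rewrite divfK ?lt0r_neq0 ?energy0_gt0.
have e1 : 0 < energy m.+1 by rewrite (lt_le_trans _ IH) // mulr_gt0 // ratio_gt0.
split=> //; rewrite -(ler_pM2l e0); apply: le_trans (energy_logconvex m).
by rewrite mulrCA mulrA expr2 ler_wpM2r // ltW.
Qed.

Lemma energy_gt0 m : 0 < energy m.
Proof. by have [] := energy_growth m. Qed.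

Lemma iter_sqr_bound n f x : unif_cont f ->
  T^n.+1 f x ^+ 2 <= energy n * mean (fun x => f x ^+ 2).
Proof.
move=> uf; rewrite iter_kernel //.
rewrite -[X in _ * X](mean_shift x); last exact: unif_cont_sqr.
under [X in _ * mean X]eq_fun do rewrite addrC.
apply: cauchy_schwarz; [exact: unif_cont_iter|exact: unif_cont_shiftl].
Qed.

Lemma mean_sqr_le f b : unif_cont f -> (forall x, f x ^+ 2 <= b) ->
  mean (fun x => f x ^+ 2) <= b.
Proof.
move=> uf fb; rewrite -[leRHS](mean_cst G); apply: mean_le => //.
  exact: unif_cont_sqr.
exact: unif_cont_cst.
Qed.

(** Factor [T^(2m+2)] into two equal powers and apply the Cauchy-Schwarz
    inequality to each. *)
Lemma iter_bound m f b x : unif_cont f -> (forall y, `|f y| <= b) ->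
  `|T^m.*2.+2 f x| <= b * energy m.
Proof.
move=> uf fb; have b0 : 0 <= b by apply: le_trans (fb 0).
have fb2 y : f y ^+ 2 <= b ^+ 2 by rewrite -real_normK ?num_real // ler_pXn2r ?nnegrE.
have e0 := energy_gt0 m.
suff : T^m.*2.+2 f x ^+ 2 <= (b * energy m) ^+ 2.
  by rewrite -[X in X <= _]real_normK ?num_real // ler_pXn2r // nnegrE mulr_ge0 // ltW.
rewrite -addnn -addSn -addnS iterD.
apply: le_trans (iter_sqr_bound _ _ _) _; first exact: unif_cont_iter.
have -> : (b * energy m) ^+ 2 = energy m * (b ^+ 2 * energy m) by ring.
rewrite ler_wpM2l ?(ltW e0) //.
apply: mean_sqr_le => [|y]; first exact: unif_cont_iter.
apply: le_trans (iter_sqr_bound _ _ uf) _.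
by rewrite mulrC ler_wpM2r ?(ltW e0) // mean_sqr_le.
Qed.

(** Translating [T g] amounts to translating the kernel, which moves by at most
    [psi x]; the modulus of continuity of [g] does not enter. *)
Lemma corr_smooth g b x z : unif_cont g -> (forall y, `|g y| <= b) ->
  `|T g (z + x) - T g z| <= psi x * b.
Proof.
move=> ug gb; have b0 : 0 <= b by apply: le_trans (gb 0).
have ukx : unif_cont (fun y => k (y - x)) by exact: unif_cont_shift.
have -> : T g (z + x) = corr (fun y => k (y - x)) g z.
  rewrite /corr -(mean_shift (- x)); last exact: unif_cont_corr_body.
  by apply: eq_mean => y; rewrite addrA (addrAC z) -addrA subrr addr0.
rewrite /corr -meanB //; try exact: unif_cont_corr_body.
apply: mean_norm.
  by apply: unif_contB; exact: unif_cont_corr_body.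
move=> y; rewrite -mulrBl normrM ler_pM //.
by have := k_psi x (y - x); rewrite subrK distrC.
Qed.

(** Asymptotically only the part of [f] that the powers of [T] shrink the least
    matters, so the seminorm [growth] below is in effect a norm on the eigenspace of
    [T \o T] for its largest eigenvalue; no eigenvector has to be constructed. *)
Definition dominated f b := exists m0, forall m, (m0 <= m)%N ->
  forall x, `|T^m.*2.+2 f x| <= b * energy m.

Definition growth f : R := inf [set b | dominated f b].

Lemma dominated_ge0 f b : dominated f b -> 0 <= b.
Proof.
move=> [m0 /(_ m0 (leqnn _) 0) H].
by rewrite -(pmulr_lge0 _ (energy_gt0 m0)); apply: le_trans H.
Qed.

Lemma dominated_lb f : has_lbound [set b | dominated f b].
Proof. by exists 0 => b /dominated_ge0. Qed.

Lemma dominated_bound f b : unif_cont f -> (forall x, `|f x| <= b) -> dominated f b.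
Proof. by move=> uf fb; exists 0%N => m _ x; exact: iter_bound. Qed.

Lemma growth_le f b : dominated f b -> growth f <= b.
Proof. by move=> fb; apply: ge_inf => //; exact: dominated_lb. Qed.

Lemma growth_has_inf f : unif_cont f -> has_inf [set b | dominated f b].
Proof.
move=> uf; split; last exact: dominated_lb.
have [b b0 fb] := unif_cont_bounded uf; exists b; exact: dominated_bound.
Qed.

Lemma growth_ge0 f : unif_cont f -> 0 <= growth f.
Proof.
move=> /growth_has_inf[f0 _]; apply: lb_le_inf => //.
by move=> b /dominated_ge0.
Qed.

Lemma growth_dominated f b : unif_cont f -> growth f < b -> dominated f b.
Proof.
move=> /growth_has_inf fi gb.
have [c /= [m0 H] cb] := inf_lt (proj1 fi) gb.
exists m0 => m m0m x; apply: le_trans (H m m0m x) _.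
by rewrite ler_wpM2r ?(ltW cb) // ltW ?energy_gt0.
Qed.

Opaque growth.

Lemma growth_ler f b : unif_cont f ->
  (forall e, 0 < e -> dominated f (b + e)) -> growth f <= b.
Proof. by move=> uf H; apply/ler_addgt0Pr => e e0; exact/growth_le/H. Qed.

Lemma growthD f g : unif_cont f -> unif_cont g ->
  growth (fun x => f x + g x) <= growth f + growth g.
Proof.
move=> uf ug; apply: growth_ler => [|e e0]; first exact: unif_contD.
have [m0 Hf] : dominated f (growth f + e / 2).
  by apply: growth_dominated => //; rewrite ltrDl divr_gt0.
have [m1 Hg] : dominated g (growth g + e / 2).
  by apply: growth_dominated => //; rewrite ltrDl divr_gt0.
exists (maxn m0 m1) => m; rewrite geq_max => /andP[h0 h1] x.
have -> : T^m.*2.+2 (fun x => f x + g x) x =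
    T^m.*2.+2 f x - T^m.*2.+2 (fun x => -1 * g x) x.
  rewrite -iterB //; last exact: unif_contZ.
  rewrite (_ : (fun x => f x + g x) = fun y => f y - -1 * g y) //.
  by apply/funext => y; rewrite mulN1r opprK.
rewrite iterZ // mulN1r opprK (le_trans (ler_normD _ _)) //.
have -> : growth f + growth g + e = growth f + e / 2 + (growth g + e / 2).
  by rewrite addrACA -splitr.
by rewrite mulrDl; apply: lerD; [exact: Hf|exact: Hg].
Qed.

Lemma growthZ c f : unif_cont f -> growth (fun x => c * f x) <= `|c| * growth f.
Proof.
move=> uf; apply: growth_ler => [|e e0]; first exact: unif_contZ.
have e' : 0 < e / (1 + `|c|) by rewrite divr_gt0 // ltr_pwDl.
have [m0 H] : dominated f (growth f + e / (1 + `|c|)).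
  by apply: growth_dominated => //; rewrite ltrDl.
exists m0 => m m0m x; rewrite iterZ // normrM.
apply: le_trans (ler_wpM2l _ (H m m0m x)) _ => //.
rewrite mulrA ler_wpM2r ?(ltW (energy_gt0 m)) // mulrDr lerD2l.
rewrite mulrCA; apply: ler_piMr; first exact: ltW.
by rewrite ler_pdivrMr ?ltr_pwDl // mul1r lerDr.
Qed.

Lemma growth_shift a f : unif_cont f -> growth (fun x => f (x + a)) <= growth f.
Proof.
move=> uf; apply: growth_ler => [|e e0]; first exact: unif_cont_shift.
have [m0 H] : dominated f (growth f + e).
  by apply: growth_dominated => //; rewrite ltrDl.
by exists m0 => m m0m x; rewrite iter_shift; exact: H.
Qed.

Definition displ a f x : R := f (x + a) - f x.

Lemma unif_cont_displ a f : unif_cont f -> unif_cont (displ a f).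
Proof. by move=> uf; apply: unif_contB => //; exact: unif_cont_shift. Qed.

Lemma iter_displ n a f x : unif_cont f -> T^n (displ a f) x = displ a (T^n f) x.
Proof.
by move=> uf; rewrite iterB ?iter_shift //; exact: unif_cont_shift.
Qed.

Lemma growth_displ a f : unif_cont f -> growth (displ a f) <= 2 * growth f.
Proof.
move=> uf; have uN : unif_cont (fun x => -1 * f x) by exact: unif_contZ.
have -> : displ a f = fun x => f (x + a) + -1 * f x.
  by apply/funext => x; rewrite mulN1r.
apply: le_trans (growthD (unif_cont_shift a uf) uN) _.
rewrite [leRHS]mulr_natl [leRHS]mulr2n; apply: lerD; first exact: growth_shift.
by apply: le_trans (growthZ (-1) uf) _; rewrite normrN1 mul1r.
Qed.

(** On the dominant part one application of [T] can be undone at the bounded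
    cost [ratio^-1], so the smoothing by [T] makes translations continuous for
    [growth] in operator norm, which they are not for the supremum norm. *)
Lemma growth_smooth : exists2 C : R, 0 < C &
  forall x f, unif_cont f -> growth (displ x f) <= C * psi x * growth f.
Proof.
have [B B0 kB] := unif_cont_bounded uk.
exists (B / ratio); first by rewrite divr_gt0 // ratio_gt0.
move=> x f uf.
have p0 : 0 <= psi x by apply: le_trans (k_psi x 0).
have c0 : 0 <= B / ratio * psi x.
  by rewrite mulr_ge0 // divr_ge0 // ltW // ratio_gt0.
apply: growth_ler => [|e e0]; first exact: unif_cont_displ.
set c := B / ratio * psi x in c0 *.
have e' : 0 < e / (1 + c) by rewrite divr_gt0 // ltr_pwDl.
have [m0 H] : dominated f (growth f + e / (1 + c)).
  by apply: growth_dominated => //; rewrite ltrDl.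
set b := growth f + e / (1 + c) in H.
have b0 : 0 <= b by rewrite addr_ge0 ?growth_ge0 // ltW.
exists m0.+1 => -[//|m] m0m z; rewrite doubleS.
apply: (@le_trans _ _ (B * (psi x * (b * energy m)))).
  rewrite iterS; apply: corr_norm => //.
    by apply: unif_cont_iter; exact: unif_cont_displ.
  move=> y; rewrite iter_displ // /displ iterS.
  by apply: corr_smooth => [|w]; [exact: unif_cont_iter|exact: H].
apply: (@le_trans _ _ (c * b * energy m.+1)).
  have [_ g] := energy_growth m.
  have -> : B * (psi x * (b * energy m)) = c * b * (ratio * energy m).
    rewrite /c; have := lt0r_neq0 ratio_gt0.
    by move: ratio (psi x) (energy m) (b) => ? ? ? ? ?; field.
  by rewrite ler_wpM2l // mulr_ge0.
rewrite ler_wpM2r ?(ltW (energy_gt0 _)) // /b mulrDr lerD2l.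
rewrite mulrCA; apply: ler_piMr; first exact: ltW.
by rewrite ler_pdivrMr ?ltr_pwDl // mul1r lerDr.
Qed.

(** The operator norm, with respect to [growth], of a translation minus the
    identity. *)
Definition escape x : R :=
  sup [set growth (displ x f) | f in [set f | unif_cont f /\ growth f <= 1]].

Lemma growth0 : growth (fun=> 0) <= 0.
Proof.
apply: growth_le; apply: dominated_bound; first exact: unif_cont_cst.
by move=> x; rewrite normr0.
Qed.

Lemma escape_ge f x : unif_cont f -> growth f <= 1 -> growth (displ x f) <= escape x.
Proof.
move=> uf f1; apply: ub_le_sup; last by exists f.
exists 2 => _ [g [ug g1] <-]; apply: le_trans (growth_displ x ug) _.
by rewrite -[leRHS]mulr1 ler_wpM2l.
Qed.

Lemma escape_le x b : (forall f, unif_cont f -> growth f <= 1 ->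
  growth (displ x f) <= b) -> escape x <= b.
Proof.
move=> H; apply: ge_sup.
  exists (growth (displ x (fun=> 0))); exists (fun=> 0) => //; split.
    exact: unif_cont_cst.
  by rewrite (le_trans growth0).
by move=> _ [f [uf f1] <-]; exact: H.
Qed.

Lemma escape_ge0 x : 0 <= escape x.
Proof.
apply: (@le_trans _ _ (growth (displ x (fun=> 0)))); last first.
  by apply: escape_ge; [exact: unif_cont_cst|rewrite (le_trans growth0)].
by apply: growth_ge0; apply: unif_cont_displ; exact: unif_cont_cst.
Qed.

Lemma growth_escape f x : unif_cont f -> growth (displ x f) <= escape x * growth f.
Proof.
move=> uf; have := growth_ge0 uf; rewrite le_eqVlt => /predU1P[f0|f0].
  by apply: le_trans (growth_displ x uf) _; rewrite -f0 !mulr0.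
have c0 : 0 < (growth f)^-1 by rewrite invr_gt0.
have ug : unif_cont (fun y => (growth f)^-1 * f y) by exact: unif_contZ.
have g1 : growth (fun y => (growth f)^-1 * f y) <= 1.
  apply: le_trans (growthZ _ uf) _.
  by rewrite gtr0_norm // mulVf // gt_eqF.
have ud := unif_cont_displ x ug.
have -> : displ x f = fun y => growth f * displ x (fun y => (growth f)^-1 * f y) y.
  by apply/funext => y; rewrite /displ -mulrBr mulrA mulfV ?mul1r // gt_eqF.
apply: le_trans (growthZ _ ud) _.
rewrite (gtr0_norm f0) mulrC; apply: ler_wpM2r; first exact: ltW.
exact: escape_ge.
Qed.

Lemma escapeD x y : escape (x + y) <= escape x + escape y.
Proof.
apply: escape_le => f uf f1.
have -> : displ (x + y) f = fun z => displ x (fun w => f (w + y)) z + displ y f z.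
  by apply/funext => z; rewrite /displ addrA addrA subrK.
apply: le_trans (growthD _ _) _; try by apply: unif_cont_displ => //;
  exact: unif_cont_shift.
apply: lerD; last exact: escape_ge.
apply: escape_ge; first exact: unif_cont_shift.
exact: le_trans (growth_shift y uf) f1.
Qed.

Lemma escapeN_le x : escape (- x) <= escape x.
Proof.
apply: escape_le => f uf f1.
have us : unif_cont (fun y => f (y - x)) by exact: unif_cont_shift.
have -> : displ (- x) f = fun z => -1 * displ x (fun y => f (y - x)) z.
  by apply/funext => z; rewrite /displ mulN1r opprB addrK.
apply: le_trans (growthZ _ _) _; first exact: unif_cont_displ.
rewrite normrN1 mul1r; apply: escape_ge; first exact: us.
exact: le_trans (growth_shift _ uf) f1.
Qed.

Lemma escapeMn n x : escape (x *+ n) <= n%:R * escape x.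
Proof.
elim: n => [|n IH].
  rewrite mulr0n mul0r; apply: escape_le => f uf f1.
  have -> : displ 0 f = fun=> 0 by apply/funext => y; rewrite /displ addr0 subrr.
  exact: growth0.
by rewrite mulrSr -natr1 mulrDl mul1r (le_trans (escapeD _ _)) // lerD2r.
Qed.

(** Expand the translation by [x *+ n] to second order: with [D = displ x], the
    error [displ (x *+ n) - n D] is the sum over [m < n] of the products
    [displ (x *+ m) D], whose norms are at most [m * escape x ^+ 2]. *)
Lemma escapeP n x : n%:R * escape x <= escape (x *+ n) + (n%:R * escape x) ^+ 2 / 2.
Proof.
case: n => [|n'].
  rewrite !mul0r expr0n /= mul0r addr0; exact: escape_ge0.
set n := n'.+1; have n0 : 0 < n%:R :> R by rewrite ltr0n.
rewrite -ler_pdivlMl //; apply: escape_le => f uf f1.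
have ud a : unif_cont (displ a f) by exact: unif_cont_displ.
pose E m z := displ (x *+ m) f z + (- m%:R) * displ x f z.
have uE m : unif_cont (E m) by apply: unif_contD => //; exact: unif_contZ.
have HE m : growth (E m) <= (m%:R * escape x) ^+ 2 / 2.
  elim: m => [|m IH].
    have -> : E 0%N = fun=> 0.
      by apply/funext => z; rewrite /E /displ mulr0n addr0 subrr oppr0 mul0r addr0.
    by rewrite mul0r expr0n /= mul0r growth0.
  have -> : E m.+1 = fun z => E m z + displ (x *+ m) (displ x f) z.
    apply/funext => z; rewrite /E /displ mulrSr addrA -natr1.
    by ring.
  apply: le_trans (growthD (uE m) (unif_cont_displ _ (ud x))) _.
  have : growth (displ (x *+ m) (displ x f)) <= m%:R * escape x * escape x.
    apply: le_trans (growth_escape _ (ud x)) _.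
    apply: ler_pM; first exact: escape_ge0.
    - exact: growth_ge0.
    - exact: escapeMn.
    - exact: escape_ge.
  rewrite -natr1; move: (escape_ge0 x) (ler0n R m) IH.
  move: (escape x) (growth _) (growth _) m%:R => ? ? ? ?; nra.
rewrite ler_pdivlMl //.
have : growth (fun z => n%:R * displ x f z) <=
  growth (displ (x *+ n) f) + growth (E n).
  have -> : (fun z => n%:R * displ x f z) = fun z => displ (x *+ n) f z + -1 * E n z.
    by apply/funext => z; rewrite /E; ring.
  apply: le_trans (growthD (ud _) (unif_contZ (-1) (uE n))) _.
  rewrite lerD2l; apply: le_trans (growthZ _ (uE n)) _.
  by rewrite normrN1 mul1r.
have : growth (displ (x *+ n) f) <= escape (x *+ n) by exact: escape_ge.
have := HE n.
have : n%:R * growth (displ x f) <= growth (fun z => n%:R * displ x f z).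
  rewrite -ler_pdivlMl //.
  have e1 : displ x f = fun z => n%:R^-1 * (n%:R * displ x f z).
    by apply/funext => z; rewrite mulKf // gt_eqF.
  rewrite {1}e1; apply: le_trans (growthZ _ _) _; first exact: unif_contZ.
  by rewrite gtr0_norm // invr_gt0.
move: (escape x) (escape _) (growth _) (growth _) (growth _) (growth _) => *; lra.
Qed.

Hypothesis psi_small : forall e, 0 < e -> exists2 r : R, 0 < r &
  forall x, nu x < r -> psi x <= e.

(** If all translations acted trivially for [growth], the normalized images of
    [T k] would be nearly constant, hence nearly 0 because their mean is 0; but at
    0 they are at least [ratio]. *)
Lemma escape_nontrivial : exists x, 0 < escape x.
Proof.
apply: contrapT => /forallNP H.
have [B B0 kB] := unif_cont_bounded uk.
have uTk : unif_cont (T k) by exact: unif_cont_corr.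
have TkB x : `|T k x| <= B * B by exact: corr_norm.
have r0 := ratio_gt0.
(* The contradiction below is [ratio <= e + 4 * e]. *)
have [e e0 er] : exists2 e : R, 0 < e & ratio = 16 * e.
  by exists (ratio / 16); [rewrite divr_gt0|rewrite mulrC divfK].
have eB : 0 < e / B by rewrite divr_gt0.
have [r rr0 Hr] := psi_small eB.
have [s s0 Hs] := avg_near_mean (B * B) rr0 e0.
have : exists m0, forall m, (m0 <= m)%N -> forall a, a \in s ->
    `|displ a (T^m.*2.+2 (T k)) 0| <= e * energy m.
  elim: (s) => [|a t [m0 IH]]; first by exists 0%N.
  have [m1 Ha] : dominated (displ a (T k)) e.
    apply: growth_dominated; first exact: unif_cont_displ.
    apply: le_lt_trans e0; apply: le_trans (growth_escape a uTk) _.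
    apply: mulr_le0_ge0; last exact: growth_ge0.
    by rewrite leNgt; apply/negP; exact: H.
  exists (maxn m0 m1) => m; rewrite geq_max => /andP[h0 h1] d.
  rewrite inE => /predU1P[->|]; last exact: IH.
  by rewrite -iter_displ //; exact: Ha.
move=> [m Hm]; have {Hm} := Hm m (leqnn m).
have em := energy_gt0 m; have em0 := lt0r_neq0 em.
set F := T^m.*2.+2 (T k) => HF.
have uF : unif_cont F by exact: unif_cont_iter.
pose f x := (energy m)^-1 * F x.
have nf x b : `|F x| <= b * energy m -> `|(energy m)^-1 * F x| <= b.
  by move=> Fb; rewrite normrM gtr0_norm ?invr_gt0 // mulrC ler_pdivrMr.
have fb x : `|f x| <= B * B.
  by apply: nf; exact: iter_bound.
have fr x y : nu y < r -> `|f (x + y) - f x| <= e.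
  move=> /Hr py; rewrite /f -mulrBr normrM gtr0_norm ?invr_gt0 // mulrC.
  rewrite ler_pdivrMr // /F -iterSr iterS.
  apply: (@le_trans _ _ (psi y * (B * energy m))).
    apply: corr_smooth; first exact: unif_cont_iter.
    by move=> z; exact: iter_bound.
  by rewrite mulrA ler_wpM2r ?(ltW em) // -ler_pdivlMr.
have mf : mean f = 0.
  rewrite meanZ // /F -iterSr iter_mean // mulr0 //.
have := Hs f fb fr 0; rewrite mf subr0.
have : `|avg s f 0 - f 0| <= e.
  apply: avg_dist_in => // a /HF.
  rewrite /displ !add0r /f -mulrBr normrM gtr0_norm ?invr_gt0 // => h.
  by rewrite mulrC ler_pdivrMr.
have : ratio <= f 0.
  rewrite /f /F -iterSr (energy_at0 m.+1) mulrC ler_pdivlMr //.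
  by have [] := energy_growth m.
rewrite !ler_norml => h1 /andP[h2 h3] /andP[h4 h5].
move: h1 h2 h3 h4 h5; rewrite er; move: (avg _ _ _) (f 0) e0.
by move=> u v e_gt0 h1 h2 h3 h4 h5; lra.
Qed.

End Gleason.

(** A pseudonorm with the escape property: below its scale, multiplication by [n]
    multiplies it almost by [n]. It replaces a nontrivial character of the group,
    for which the distance to 1 of the values has this property. *)
Theorem escape_pseudonorm (psi : G -> R) :
  (forall x, psi (- x) = psi x) -> (forall x y, psi (x + y) <= psi x + psi y) ->
  (forall e, 0 < e -> exists2 r : R, 0 < r & forall x, nu x < r -> psi x <= e) ->
  (exists x, psi x != psi 0) ->
  exists q : G -> R,
    [/\ forall x, 0 <= q x,
        forall x y, q (x + y) <= q x + q y,
        forall x, q (- x) <= q x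
      & forall n x, n%:R * q x <= q (x *+ n) + (n%:R * q x) ^+ 2 / 2] /\
    (exists2 C : R, 0 < C & forall x, q x <= C * psi x) /\
    exists x, 0 < q x.
Proof.
move=> psiN psiD psi_small [x1 px1].
have pdist x y : `|psi (y + x) - psi y| <= psi x.
  rewrite ler_norml; apply/andP; split; last by rewrite lerBlDl.
  have := psiD (y + x) (- x); rewrite addrK psiN; lra.
have upsi : unif_cont psi.
  move=> e /psi_small[r r0 Hr]; exists r => // x y /Hr; exact: le_trans.
pose k x := psi x - mean psi.
have uk : unif_cont k by apply: unif_contB => //; exact: unif_cont_cst.
have kN x : k (- x) = k x by rewrite /k psiN.
have k0 : mean k = 0 by rewrite /k meanB ?mean_cst ?subrr //; exact: unif_cont_cst.
have kne : exists x, k x != 0.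
  apply: contrapT => /forallNP H.
  have e x : psi x = mean psi.
    by apply/eqP; rewrite -subr_eq0; apply: contrapT => /negP; exact: H.
  by rewrite (e x1) (e 0) eqxx in px1.
have kpsi x y : `|k (y + x) - k y| <= psi x.
  by rewrite /k opprB addrA subrK.
exists (escape k); split; [split|split].
- exact: escape_ge0.
- exact: escapeD.
- exact: escapeN_le.
- exact: escapeP.
- have [C C0 HC] := growth_smooth uk kN kne kpsi; exists C => // x.
  apply: escape_le => // f uf f1; apply: le_trans (HC x f uf) _.
  apply: ler_piMr => //; apply: mulr_ge0; first exact: ltW.
  exact: le_trans (kpsi x 0).
- exact: (escape_nontrivial uk kN k0 kne kpsi psi_small).
Qed.

End Mean.

(** * Compact metrizable groups *)

(** [nu (y - x)] is then a translation-invariant metric for the topology;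
    nonnegativity and [nu 0 = 0] follow from the three clauses. *)
Definition group_norm (R : realType) (G : topologicalZmodType) (nu : G -> R) :=
  [/\ forall x, nu (- x) = nu x,
      forall x y, nu (x + y) <= nu x + nu y
    & forall x (A : set G),
        nbhs x A <-> exists2 e, 0 < e & [set y | nu (y - x) < e] `<=` A].

Section CompactMetrizableGroup.
Variables (R : realType) (G : topologicalZmodType).
Hypothesis G_compact : compact [set: G].
Implicit Types (x y z : G) (A H : set G).

Lemma near_add x y A : nbhs (x + y) A ->
  \forall u \near x & v \near y, A (u + v).
Proof. by move=> /(@add_continuous G (x, y)). Qed.

Lemma near_addl x y A : nbhs (x + y) A -> \forall u \near x, A (u + y).
Proof.
move=> /near_add[[U V] /= [Ux Vy] UV].
by apply: filterS Ux => u Uu; apply: (UV (u, y)); split => //=; exact: nbhs_singleton.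
Qed.

(** Taking the supremum of the metric over all translates makes it invariant;
    compactness keeps the supremum finite and the topology unchanged. *)
Lemma metrizable_group_norm : metrizable R G -> exists nu : G -> R, group_norm nu.
Proof.
move=> [d [d0 _ dC dT dN]].
have dge x y : 0 <= d x y by have := dT x y x; rewrite d0 (dC y x); lra.
have dball x e : 0 < e -> nbhs x [set y | d x y < e].
  by move=> e0; apply/dN; exists e.
have [B HB] : exists B : nat, forall x, d 0 x < B%:R.
  have := (compact_near_coveringP [set: G]).1 G_compact nat \oo
    (fun n x => d 0 x < n%:R) _.
  case=> [x _|N _ HN]; last by exists N => x; apply: (HN N) => /=.
  exists ([set y | d x y < 1], [set n | d 0 x + 1 < n%:R]).
    by split => /=; [exact: dball|exact: nbhs_infty_gtr].
  move=> [y n] [/= y1 n1]; apply: le_lt_trans (dT 0 x y) _; lra.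
have bd x z : d (x + z) z <= B%:R + B%:R.
  by apply: le_trans (dT _ 0 _) _; rewrite dC lerD // ltW.
pose S x := [set d (x + z) z | z in [set: G]].
pose nu x := sup (S x).
have le_nu x z : d (x + z) z <= nu x.
  apply: ub_le_sup; last by exists z.
  by exists (B%:R + B%:R) => _ [w _ <-].
have nu_le x b : (forall z, d (x + z) z <= b) -> nu x <= b.
  move=> H; apply: ge_sup; first by exists (d (x + 0) 0); exists 0.
  by move=> _ [z _ <-].
have nuN x : nu (- x) <= nu x.
  by apply: nu_le => z; rewrite dC; have := le_nu x (- x + z); rewrite addNKr.
have nu_small e : 0 < e -> nbhs 0 [set x | nu x < e].
  move=> e0; have e2 : 0 < e / 2 by lra.
  have : \forall x \near 0, [set: G] `<=` (fun z => d (x + z) z < e / 2).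
    apply: (compact_near_coveringP [set: G]).1 => // z _.
    have e4 : 0 < e / 2 / 2 by lra.
    have Vz := dball z _ e4.
    have := @near_add 0 z [set w | d z w < e / 2 / 2].
    rewrite add0r => /(_ Vz)[[U W] /= [U0 Wz] UW].
    exists ([set y | d z y < e / 2 / 2] `&` W, U); first by split => //=; exact: filterI.
    move=> [y x] /= [[zy Wy] Ux].
    have := dT (x + y) z y; have := UW (x, y) (conj Ux Wy); rewrite /= (dC _ z); lra.
  apply: filterS => x /= H; apply: (@le_lt_trans _ _ (e / 2)); last by lra.
  by apply: nu_le => z; apply/ltW/H.
exists nu; split.
- by move=> x; apply/eqP; rewrite eq_le nuN -{1}[x]opprK nuN.
- move=> x y; apply: nu_le => z; rewrite -addrA.
  by apply: le_trans (dT _ (y + z) _) _; rewrite lerD.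
move=> x A; split.
  move=> /dN[e e0 eA]; exists e => // y /= ye; apply: eA => /=.
  apply: le_lt_trans ye; have := le_nu (y - x) x; rewrite subrK dC.
  exact.
move=> [e e0 eA]; apply: filterS eA _.
by have := @near_addl x (- x) [set w | nu w < e]; rewrite subrr; apply; exact: nu_small.
Qed.


Variable nu : G -> R.
Hypothesis nuG : group_norm nu.

Let nuN x : nu (- x) = nu x.
Proof. by have [] := nuG. Qed.

Let nuD x y : nu (x + y) <= nu x + nu y.
Proof. by have [] := nuG. Qed.

Lemma nbhs_norm x A :
  nbhs x A <-> exists2 e, 0 < e & [set y | nu (y - x) < e] `<=` A.
Proof. by have [] := nuG. Qed.

Lemma nbhs_norm_ball x e : 0 < e -> nbhs x [set y | nu (y - x) < e].
Proof. by move=> e0; apply/nbhs_norm; exists e. Qed.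

Lemma norm0 : nu 0 = 0.
Proof.
apply/eqP; rewrite eq_le; apply/andP; split; last first.
  by have := nuD 0 0; rewrite addr0; lra.
apply/ler_addgt0Pl => e e0; rewrite addr0 ltW //.
by have := nbhs_singleton (nbhs_norm_ball 0 e0); rewrite /= subrr.
Qed.

Lemma norm_ge0 x : 0 <= nu x.
Proof. by have := nuD x (- x); rewrite subrr norm0 nuN; lra. Qed.

Lemma norm_dist x y : nu (x - y) = nu (y - x).
Proof. by rewrite -nuN opprB. Qed.

Lemma norm_triangle z x y : nu (x - y) <= nu (x - z) + nu (z - y).
Proof. by have := nuD (x - z) (z - y); rewrite addrA subrK. Qed.

Lemma open_norm_ball a e : open [set x | nu (x - a) < e].
Proof.
rewrite openE => x /= xa; apply/nbhs_norm; exists (e - nu (x - a)).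
  by rewrite subr_gt0.
by move=> y /= yx; apply: le_lt_trans (norm_triangle x y a) _; lra.
Qed.

Lemma closed_norm_ball a e : closed [set x | nu (x - a) <= e].
Proof.
rewrite -openC openE => x /= /negP; rewrite -ltNge => xa.
apply/nbhs_norm; exists (nu (x - a) - e); first by rewrite subr_gt0.
move=> y /= yx; apply/negP; rewrite -ltNge.
by have := norm_triangle y x a; rewrite (norm_dist x y); lra.
Qed.

(** Near-covering compactness for the filter of finite lists ordered by inclusion. *)
Lemma norm_net e : 0 < e ->
  exists D : seq G, forall x, exists2 a, a \in D & nu (x - a) < e.
Proof.
move=> e0; pose F := filter_from setT (fun s : seq G => [set t : seq G | {subset s <= t}]).
have FF : Filter F.
  apply: filter_from_filter; first by exists [::].
  move=> s t _ _; exists (s ++ t) => // u su; split=> x xs; apply: su;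
    by rewrite mem_cat xs ?orbT.
have [x _|s _ Hs] := (compact_near_coveringP [set: G]).1 G_compact (seq G) F
    (fun s x => exists2 a, a \in s & nu (x - a) < e) FF.
  exists ([set y | nu (y - x) < e], [set t : seq G | {subset [:: x] <= t}]).
    by split; [exact: nbhs_norm_ball|exists [:: x]].
  by move=> [y t] /= [yx xt]; exists x => //; apply: xt; rewrite inE.
by exists s => x; apply: (Hs s).
Qed.

(** The fourth clause is the escape property of Gleason metrics, in a form that
    needs no smallness assumption: it says something only if [n%:R * q x < 2]. *)
Definition escape_norm (q : G -> R) :=
  [/\ forall x, 0 <= q x,
      forall x y, q (x + y) <= q x + q y,
      forall x, q (- x) <= q x,
      forall n x, n%:R * q x <= q (x *+ n) + (n%:R * q x) ^+ 2 / 2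
    & exists x, 0 < q x].

Definition subgroup H :=
  [/\ H 0, forall x y, H x -> H y -> H (x + y) & forall x, H x -> H (- x)].

(** The distance to [H] for the invariant metric is an [H]-invariant pseudonorm,
    nontrivial because [H] is closed and proper. *)
Lemma escape_norm_subgroup H : closed H -> subgroup H -> H <> [set: G] ->
  exists q : G -> R,
    [/\ escape_norm q, forall x, H x -> q x = 0
      & exists2 C : R, 0 < C & forall x, q x <= C * nu x].
Proof.
move=> cH [H0 HD HN] HT.
pose S x := [set nu (x + h) | h in H].
pose psi x := inf (S x).
have psi_le x h : H h -> psi x <= nu (x + h).
  move=> Hh; apply: ge_inf; last by exists h.
  by exists 0 => _ [w _ <-]; exact: norm_ge0.
have le_psi x b : (forall h, H h -> b <= nu (x + h)) -> b <= psi x.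
  move=> Hb; apply: lb_le_inf; first by exists (nu (x + 0)); exists 0.
  by move=> _ [h Hh <-]; exact: Hb.
have psi_ge0 x : 0 <= psi x by apply: le_psi => h _; exact: norm_ge0.
have psi_nu x : psi x <= nu x by have := psi_le x 0 H0; rewrite addr0.
have psi_H x : H x -> psi x = 0.
  move=> Hx; apply/eqP; rewrite eq_le psi_ge0 andbT.
  by have := psi_le x _ (HN _ Hx); rewrite subrr norm0.
have psiN_le x : psi (- x) <= psi x.
  apply: le_psi => h Hh; have := psi_le (- x) _ (HN _ Hh).
  by rewrite -opprD nuN.
have psiN x : psi (- x) = psi x.
  by apply/eqP; rewrite eq_le psiN_le -{1}[x]opprK psiN_le.
have psiD x y : psi (x + y) <= psi x + psi y.
  rewrite -lerBlDr; apply: (le_psi x) => h Hh; rewrite lerBlDr -lerBlDl.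
  apply: (le_psi y) => h' Hh'; rewrite lerBlDl.
  by have := psi_le (x + y) _ (HD _ _ Hh Hh'); rewrite addrACA; have := nuD (x + h) (y + h'); lra.
have [x1 px1] : exists x, psi x != psi 0.
  apply: contrapT => /forallNP psi0; apply: HT; apply/seteqP; split=> // x _.
  have {psi0} : psi x = 0.
    by have := psi0 x; rewrite (psi_H 0 H0) => /negP; rewrite negbK => /eqP.
  move=> px; apply: cH => B /nbhs_norm[e e0 eB].
  have [_ [h Hh <-] he] : exists2 b, S x b & b < e.
    apply: inf_lt; first by exists (nu (x + 0)); exists 0.
    by rewrite -/(psi x) px.
  exists (- h); split; first exact: HN.
  by apply: eB; rewrite /= norm_dist opprK.
have small e : 0 < e -> exists2 r : R, 0 < r & forall x, nu x < r -> psi x <= e.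
  move=> e0; exists e => // x xe; exact: le_trans (psi_nu x) (ltW xe).
have ex : exists x, psi x != psi 0 by exists x1.
have [q [[q0 qD qN qP] [[C C0 qC] qx]]] :=
  escape_pseudonorm norm_net psiN psiD small ex.
exists q; split.
- by split.
- move=> x Hx; apply/eqP; rewrite eq_le q0 andbT.
  by have := qC x; rewrite psi_H // mulr0.
- exists C => // x; apply: le_trans (qC x) _.
  by rewrite ler_wpM2l // ltW.
Qed.

Definition differences C : set G := [set v | exists2 a, C a & C (a - v)].

(** On [C] the pseudonorm of [g *+ n] is small for infinitely many [n], hence so
    is that of [v *+ n], at most 1/4, for the differences [v]. By connectedness and the escape
    property some [x] with [q x = 1/n] has [q (x *+ n) >= 1/2]; modulo the kernel of
    [q], such an [x] is as close to 0 as desired. *)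
Lemma small_multiples_differences q C (N : set nat) : connected [set: G] ->
  escape_norm q -> (exists2 c : R, 0 < c & forall x, q x <= c * nu x) ->
  (forall n, exists2 m, (n <= m)%N & N m) ->
  (forall g n, C g -> N n -> q (g *+ n) <= 8^-1) ->
  ~ nbhs 0 (differences C).
Proof.
move=> Gc [q0 qD qN qP [x1 qx1]] [c c0 qc] Ninf HC nC.
have q00 : q 0 = 0.
  by apply/eqP; rewrite eq_le q0 andbT; have := qc 0; rewrite norm0 mulr0.
have qdist x y : `|q y - q x| <= c * nu (y - x).
  have h1 := qD (y - x) x; have h2 := qD (x - y) y.
  have h3 := qN (y - x); rewrite opprB in h3.
  have h4 := qc (y - x); rewrite !subrK in h1 h2.
  by rewrite ler_norml; apply/andP; split; lra.
have q_cont : continuous q.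
  move=> x; apply/cvgrPdist_le => e e0; apply/nbhs_norm; exists (e / c).
    by rewrite divr_gt0.
  move=> y /= yx; rewrite distrC; apply: le_trans (qdist x y) _.
  by rewrite mulrC -ler_pdivlMr // ltW.
have qmul0 x n : q x = 0 -> q (x *+ n) = 0.
  move=> x0; elim: n => [|n IH]; first by rewrite mulr0n q00.
  apply/eqP; rewrite eq_le q0 andbT mulrS.
  by apply: le_trans (qD _ _) _; rewrite x0 IH addr0.
have [d d0 Hd] : exists2 d : R, 0 < d & forall x, q x < d ->
    exists2 z, q z = 0 & differences C (x - z).
  have : \forall d \near (0 : R)^'+, [set: G] `<=` (fun x => q x < d ->
    exists2 z, q z = 0 & differences C (x - z)).
    apply: (compact_near_coveringP [set: G]).1 => // x _.
    have := q0 x; rewrite le_eqVlt => /predU1P[/esym qx|qx].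
      exists ([set y | differences C (y - x)], setT).
        split => /=; last exact: filterT.
        have := @near_addl x (- x) (differences C).
        by rewrite subrr; apply.
      by move=> [y e] /= [yx _] _; exists x.
    have qx2 : 0 < q x / 2 by rewrite divr_gt0.
    exists ([set y | `|q x - q y| < q x / 2], [set e | e < q x / 2]).
      split => /=; last exact: nbhs_right_lt.
      by have /cvgrPdist_lt := q_cont x; apply.
    move=> [y e] /= [xy eq'] ye; exfalso.
    by move: xy; rewrite ltr_norml => /andP[? ?]; lra.
  move=> H; have [d [d0 Hd]] := filter_ex (filterI (nbhs_right_gt 0) H).
  by exists d => // x; exact: Hd.
pose m0 := (Num.truncn (d^-1) + Num.truncn (q x1)^-1).+1.
have [n m0n Nn] := Ninf m0.
have n0 : 0 < n%:R :> R by rewrite ltr0n (leq_trans _ m0n).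
have nlt (r : R) : 0 < r -> (Num.truncn r^-1 < n)%N -> n%:R^-1 < r.
  move=> r0 rn; rewrite invf_plt ?posrE //.
  by apply: lt_le_trans (truncnS_gt _) _; rewrite ler_nat.
have nd : n%:R^-1 < d.
  by apply: nlt => //; apply: leq_trans m0n; rewrite ltnS leq_addr.
have nq : n%:R^-1 < q x1.
  by apply: nlt => //; apply: leq_trans m0n; rewrite ltnS leq_addl.
have [x _ qx] : (q @` [set: G]) n%:R^-1.
  have : connected (q @` [set: G]).
    by apply: connected_continuous_connected => //; exact: continuous_subspaceT.
  move=> /connected_intervalP/(_ 0 (q x1)); apply.
  - by exists 0 => //; rewrite q00.
  - by exists x1.
  - by apply/andP; split; [rewrite invr_ge0 ltW|exact: ltW].
have xd : q x < d by rewrite qx.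
have [z qz [a Ca Cb]] := Hd x xd.
set b := a - (x - z) in Cb.
have xE : x *+ n = a *+ n - b *+ n + z *+ n.
  by rewrite -mulrnBl -mulrnDl /b subKr subrK.
have h1 := HC a n Ca Nn; have h2 := HC b n Cb Nn.
have h3 := qD (a *+ n - b *+ n) (z *+ n); rewrite -xE (qmul0 z n qz) in h3.
have h4 := qD (a *+ n) (- (b *+ n)); have h5 := qN (b *+ n).
have h6 := qP n x; rewrite qx mulfV ?gt_eqF // expr1n in h6.
lra.
Qed.

(** * Closed sets with thin difference sets are negligible *)

Lemma closure_norm_balls C : closed C ->
  \bigcap_j [set x | exists2 a, C a & nu (x - a) < j.+1%:R^-1] = C.
Proof.
move=> cC; apply/seteqP; split=> x; last first.
  by move=> Cx j _ /=; exists x => //; rewrite subrr norm0.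
move=> Hx; apply: cC => B /nbhs_norm[e e0 eB].
have [a Ca xa] := Hx (Num.truncn e^-1) I.
exists a; split => //; apply: eB => /=; rewrite norm_dist.
apply: lt_trans xa _; rewrite invf_plt ?posrE ?ltr0n //; exact: truncnS_gt.
Qed.

Lemma open_norm_neighborhood C e : open [set x | exists2 a, C a & nu (x - a) < e].
Proof.
rewrite (_ : [set x | _] = \bigcup_(a in C) [set x | nu (x - a) < e]).
  by apply: bigcup_open => a _; exact: open_norm_ball.
by apply/seteqP; split=> x [a Ca xa]; exists a.
Qed.

Lemma borel_open (A : set G) : open A -> @measurable _ (borel G) A.
Proof. by move=> oA; apply: sub_sigma_algebra. Qed.

Lemma borel_closed (A : set G) : closed A -> @measurable _ (borel G) A.
Proof.
move=> cA; rewrite -[A]setCK; apply: (@measurableC _ (borel G)).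
by apply: borel_open; rewrite openC.
Qed.

Lemma closed_translate C (v : G) : closed C -> closed (rotation v @` C : set G).
Proof.
move=> cC; rewrite (_ : rotation v @` C = (fun x => x - v) @^-1` C).
  by apply: preimage_closed => // x _; apply: near_addl.
apply/seteqP; split=> x /=; first by move=> [a Ca <-]; rewrite /rotation addrC addKr.
by move=> Cx; exists (x - v) => //; rewrite /rotation addrC subrK.
Qed.

(** Steinhaus: if [C] misses its translate by arbitrarily small [v], both fit
    disjointly in a small neighborhood of [C], of measure close to that of [C]. *)
Lemma haar_null_differences (mu : probability (borel G) R) C :
  haar_measure mu -> closed C -> ~ nbhs 0 (differences C) ->
  mu (C : set (borel G)) = 0%E.
Proof.
move=> muG cC nC; apply: contrapT => mC0; apply: nC.
have mC := borel_closed cC.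
pose D j : set (borel G) := [set x : G | exists2 a, C a & nu (x - a) < j.+1%:R^-1].
have mD j : measurable (D j) by apply: borel_open; exact: open_norm_neighborhood.
have DE : \bigcap_j D j = (C : set (borel G)) by exact: closure_norm_balls.
have cvgD : mu \o D @ \oo --> mu (C : set (borel G)).
  rewrite -DE; apply: nonincreasing_cvg_mu => //.
  - by rewrite (le_lt_trans (probability_le1 _ _)) ?ltry.
  - by rewrite DE.
  move=> i j ij; apply/subsetPset => x [a Ca xa]; exists a => //.
  by apply: lt_le_trans xa _; rewrite lef_pV2 ?posrE ?ltr0n // ler_nat.
have muC0 : (0 < mu (C : set (borel G)))%E.
  by rewrite lt_neqAle measure_ge0 andbT eq_sym; apply/eqP.
have muCfin : mu (C : set (borel G)) \is a fin_num by exact: fin_num_measure.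
have : (mu (C : set (borel G)) < mu (C : set (borel G)) + mu (C : set (borel G)))%E.
  by rewrite lteDr.
move=> lt2; have [j /= Dj] : exists j,
    (mu (D j) < mu (C : set (borel G)) + mu (C : set (borel G)))%E.
  have [j _ Hj] := cvgD _ (open_ereal_lt_ereal lt2).
  by exists j; exact: (Hj j (leqnn j)).
apply/nbhs_norm; exists j.+1%:R^-1 => [|v /=]; first by rewrite invr_gt0.
rewrite subr0 => vj; apply: contrapT => nv.
pose vC : set (borel G) := rotation v @` C.
have mvC : measurable vC by apply: borel_closed; exact: closed_translate.
have dis : (C : set (borel G)) `&` vC = set0.
  apply/seteqP; split=> // x [Cx [a Ca ax]]; apply: nv; exists x => //.
  by rewrite -ax /rotation addrC addKr.
move: Dj; apply/negP; rewrite -leNgt.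
rewrite -[X in (_ + X)%E](muG v C mC) -measureU //.
apply: le_measure; rewrite ?inE //; first exact: measurableU.
move=> x [Cx|[a Ca <-]]; first by exists x => //; rewrite subrr norm0 invr_gt0.
by exists a => //; rewrite /rotation addrK.
Qed.

Lemma dense_differences C : closed C -> ~ nbhs 0 (differences C) -> dense (~` C).
Proof.
move=> cC nC; apply: contrapT => /denseNE[ O [[x [oO Ox]] OC]]; apply: nC.
have OC' y : O y -> C y.
  by move=> Oy; apply: contrapT => nCy; have : set0 y by rewrite -OC.
have := @near_addl 0 x O; rewrite add0r => /(_ (open_nbhs_nbhs (conj oO Ox))).
apply: filterS => v /= Ov; exists (v + x); first exact: OC'.
by rewrite addrC addKr; exact: OC'.
Qed.

(** The Baire category theorem, by nested balls and compactness. *)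
Lemma Gdelta_dense_neq0 A : Gdelta_dense A -> A !=set0.
Proof.
move=> [F HF ->].
have step (n : nat) (O : set G) : exists O' : set G, open O -> O !=set0 ->
    [/\ open O', O' !=set0 & closure O' `<=` O `&` F n].
  have [[oO O0]|nO] := pselect (open O /\ O !=set0); last first.
    by exists set0 => oO O0; exfalso; apply: nO.
  have [oF dF] := HF n; have [x [Ox Fx]] := dF O O0 oO.
  have [e e0 eOF] : exists2 e, 0 < e & [set y | nu (y - x) < e] `<=` O `&` F n.
    by apply/nbhs_norm; apply: open_nbhs_nbhs; split => //; exact: openI.
  exists [set y | nu (y - x) < e / 2] => _ _; split; first exact: open_norm_ball.
    by exists x; rewrite /= subrr norm0 divr_gt0.
  apply: subset_trans eOF; apply: (@subset_trans _ [set y | nu (y - x) <= e / 2]).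
    rewrite [X in _ `<=` X](closure_id _).1; last exact: closed_norm_ball.
    by apply: closure_subset => y /= /ltW.
  by move=> y /= /le_lt_trans; apply; lra.
pose next n := projT1 (choice (step n)).
have Hnext n := projT2 (choice (step n)).
pose O := fix O (n : nat) : set G := if n is n'.+1 then next n' (O n') else [set: G].
have HO n : open (O n) /\ O n !=set0.
  elim: n => [|n [oO O0]]; first by split; [exact: openT|exists 0].
  by have [] := Hnext n (O n) oO O0.
have OS n : closure (O n.+1) `<=` O n `&` F n.
  by have [oO O0] := HO n; have [] := Hnext n (O n) oO O0.
have Omono n m : (n <= m)%N -> O m `<=` O n.
  move=> /subnK <-; elim: (m - n)%N => // k IH x Ox; apply: IH.
  by have [] := OS _ _ (subset_closure Ox).
have [u Hu] := choice (fun n => (HO n).2).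
have [p [_ pu]] : [set: G] `&` cluster (u @ \oo) !=set0.
  by apply: G_compact; exact: filterT.
exists p => n _; suff /OS[] : closure (O n.+1) p by [].
move=> B pB; apply: pu => //.
by exists n.+1 => // m /= nm; apply: (Omono _ _ nm); exact: Hu.
Qed.

(** * Skew orbits over a minimal system *)

(** In a compact group the multiples of [t] return near 0, so [- t] is a limit of
    multiples of [t]. *)
Lemma closed_semigroup_subgroup H : closed H -> H 0 ->
  (forall x y, H x -> H y -> H (x + y)) -> subgroup H.
Proof.
move=> cH H0 HD; split=> // t Ht.
have Hmul n : H (t *+ n).
  by elim: n => [|n IH]; rewrite ?mulr0n // mulrS; exact: HD.
have [c [_ ct]] : [set: G] `&` cluster ((fun n => t *+ n) @ \oo) !=set0.
  by apply: G_compact; exact: filterT.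
apply: cH => B /nbhs_norm[e e0 eB]; have e2 : 0 < e / 2 by lra.
have near_c N : exists2 m, (N <= m)%N & nu (t *+ m - c) < e / 2.
  have [_ [[m /= Nm <-] mc]] : (fun n => t *+ n) @` [set m | (N <= m)%N]
      `&` [set y | nu (y - c) < e / 2] !=set0.
    apply: ct; last exact: nbhs_norm_ball.
    by exists N => // m /= Nm; exists m.
  by exists m.
have [n _ nc] := near_c 0%N; have [m nm mc] := near_c n.+1.
exists (t *+ (m - n.+1)); split; first exact: Hmul.
apply: eB; rewrite /= opprK -mulrSr subnSK // mulrnBr; last exact: ltnW.
have := norm_triangle c (t *+ m) (t *+ n); rewrite (norm_dist c); lra.
Qed.

(** A closed invariant set [M] over a minimal system has nonempty fibres, and no
    full fibre unless it is everything. The translations mapping the fibre over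
    [x0] into itself form a proper closed subgroup [H]. When [iter n T x0] is near
    [x0], the fibre over it contains the fibre over [x0] translated by [g *+ n] and
    is almost contained in the fibre over [x0]; so [g *+ n] is close to [H]. *)
Lemma return_times_near_subgroup (X : topologicalType) (T : X -> X) (g : G) (x0 : X) :
  minimal T -> ~ minimal (prod_fun T (rotation g)) ->
  exists H, [/\ closed H, subgroup H, H <> [set: G] &
    forall W, open W -> H `<=` W ->
      exists2 U, nbhs x0 U & forall n, U (iter n T x0) -> W (g *+ n)].
Proof.
move=> Tmin /existsNP[M /not_implyP[cM /not_implyP[[[x1 h1] Mxh1]
  /not_implyP[MT MnT]]]].
have Mstep (w : X) h : M (w, h) -> M (T w, g + h).
  by move=> Mwh; apply: MT; exists (w, h).
have Miter n (w : X) h : M (w, h) -> M (iter n T w, h + g *+ n).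
  elim: n => [|n IH] Mwh; first by rewrite mulr0n addr0.
  by rewrite mulrS addrCA; apply: Mstep; exact: IH.
have near_nM (w : X) h : ~ M (w, h) -> exists U : set X, exists2 V : set G,
    nbhs w U /\ nbhs h V & forall u k, U u -> V k -> ~ M (u, k).
  move=> nM; have : open (~` M) by rewrite openC.
  rewrite openE => /(_ (w, h) nM)[[U V] /= [Uw Vh] UV].
  by exists U, V => // u k Uu Vk; exact: (UV (u, k)).
have fibre (w : X) : exists h, M (w, h).
  suff : [set w : X | exists h, M (w, h)] = [set: X] by move/seteqP => [_]; exact.
  apply: Tmin; last 2 first.
  - by exists x1, h1.
  - by move=> _ [u [h Muh] <-]; exists (g + h); exact: Mstep.
  rewrite -openC openE => u /= /forallNP nM.
  have : \forall u' \near u, [set: G] `<=` (fun h => ~ M (u', h)).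
    apply: (compact_near_coveringP [set: G]).1 => // h _.
    have [U [V [Uu Vh] UV]] := near_nM u h (nM h).
    by exists (V, U) => // -[k u'] /= [Vk Uu']; exact: UV.
  by apply: filterS => u' Hu' [h Mh]; exact: (Hu' h).
have not_full (w : X) : exists h, ~ M (w, h).
  apply/existsNP => full; apply: MnT; apply/seteqP; split=> // -[u k] _.
  suff : [set w : X | forall h, M (w, h)] = [set: X].
    by move=> /seteqP[_ /(_ u I)]; exact.
  apply: Tmin; last 2 first.
  - by exists w.
  - by move=> _ [v Hv <-] h; have := Mstep v _ (Hv (h - g)); rewrite addrC subrK.
  rewrite -openC openE => v /= /existsNP[h nM].
  have [U [V [Uv Vh] UV]] := near_nM v h nM.
  apply: filterS Uv => v' Uv' /(_ h); apply: UV => //.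
  exact: nbhs_singleton Vh.
pose H := [set t | forall a, M (x0, a) -> M (x0, a + t)].
have cH : closed H.
  rewrite -openC openE => t /= /existsNP[a /not_implyP[Ma nM]].
  have [U [V [Ux0 Vat] UV]] := near_nM _ _ nM; rewrite addrC in Vat.
  apply: filterS (near_addl Vat) => t' Vt' /(_ a Ma).
  by apply: UV; [exact: nbhs_singleton Ux0|rewrite addrC].
exists H; split.
- exact: cH.
- apply: closed_semigroup_subgroup.
  + exact: cH.
  + by move=> a /=; rewrite addr0.
  + by move=> s t Hs Ht a Ma; rewrite addrA; apply: Ht; exact: Hs.
- move=> /seteqP[_ HT]; have [a Ma] := fibre x0; have [h nMh] := not_full x0.
  by apply: nMh; have := HT (h - a) I a Ma; rewrite addrC subrK.
move=> W oW HW.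
have : \forall w \near x0, [set: G] `<=`
    (fun t => W t \/ ~ (forall a, M (x0, a) -> M (w, a + t))).
  apply: (compact_near_coveringP [set: G]).1 => // t _.
  have [/HW Wt|/existsNP[a /not_implyP[Ma nM]]] :=
    pselect (forall a, M (x0, a) -> M (x0, a + t)).
    exists (W, [set: X]); first by split; [exact: open_nbhs_nbhs|exact: filterT].
    by move=> [t' w] [/= Wt' _]; left.
  have [U [V [Ux0 Vat] UV]] := near_nM _ _ nM; rewrite addrC in Vat.
  exists ([set t' | V (t' + a)], U); first by split => //; exact: near_addl Vat.
  move=> [t' w] [/= Vt' Uw]; right => /(_ a Ma); apply: UV => //.
  by rewrite addrC.
move=> HU; exists [set w | [set: G] `<=`
    (fun t => W t \/ ~ (forall a, M (x0, a) -> M (w, a + t)))] => // n.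
by move=> /(_ (g *+ n) I)[//|[]] a; exact: Miter.
Qed.

Lemma continuous_mulrn n : continuous (fun x : G => x *+ n).
Proof.
elim: n => [|n IH] x; first exact: cvg_cst.
rewrite (_ : (fun _ => _) = (fun p : G * G => p.1 + p.2) \o (fun x => (x, x *+ n))).
  apply: continuous_comp; last exact: add_continuous.
  by apply: cvg_pair; [exact: cvg_id|exact: IH].
by apply/funext => y; rewrite mulrS.
Qed.

Lemma minimal_return (X : topologicalType) (T : X -> X) (x0 : X) (U : set X) :
  continuous T -> minimal T -> nbhs x0 U ->
  forall N, exists2 n, (N <= n)%N & U (iter n T x0).
Proof.
move=> cT mT Ux0 N; pose S := [set iter n T x0 | n in [set n | (N <= n)%N]].
have : closure S = [set: X].
  apply: mT; first exact: closed_closure.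
    by exists (iter N T x0); apply: subset_closure; exists N => //=.
  move=> _ [w Sw <-] B /cT TB.
  have [_ [[n /= Nn <-] Bn]] := Sw _ TB.
  exists (iter n.+1 T x0); split => //; exists n.+1 => //=; exact: leqW.
move=> /seteqP[_ /(_ x0 I)] Sx0.
by have [_ [[n /= Nn <-] Un]] := Sx0 _ Ux0; exists n.
Qed.

(** The exceptional elements lie in countably many closed sets [C p], indexed by a
    neighborhood of [x0] and a finite union of balls in [G]; only those with
    thin difference set are kept. *)
Lemma rotation_minimal_generic (X : topologicalType) (T : X -> X) (x0 : X) :
  connected [set: G] -> minimal_system R T ->
  exists A : set G,
    [/\ Gdelta_dense A, full_haar_measure R A
      & forall g, A g -> minimal (prod_fun T (rotation g))].
Proof.
move=> Gc [[d [d0 _ _ _ dN]] cT mT].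
pose r (j : nat) : R := j.+1%:R^-1.
have r0 j : 0 < r j by rewrite invr_gt0 ltr0n.
pose U (i : nat) := [set y | d x0 y < r i].
have Ux0 i : nbhs x0 (U i) by apply/dN; exists (r i).
have [net Hnet] : exists net : nat -> seq G, forall j x,
    exists2 a, a \in net j & nu (x - a) < r j.
  have [f Hf] := choice (fun j => norm_net (r0 j)); by exists f.
pose ball j l := [set x | nu (x - nth 0 (net j) l) <= r j].
pose W j (m : seq nat) := \bigcup_(l in [set` m]) ball j l.
pose C (p : nat * nat * seq nat) :=
  \bigcap_(n in [set n | U p.1.1 (iter n T x0)]) ((fun g : G => g *+ n) @^-1` W p.1.2 p.2).
have cC p : closed (C p).
  apply: closed_bigI => n _; apply: preimage_closed.
    by move=> x _; exact: continuous_mulrn.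
  by apply: closed_bigcup => [|l _]; [exact: finite_seq|exact: closed_norm_ball].
have thin0 : ~ nbhs 0 (differences set0) by move=> /nbhs_singleton[].
pose B n : set G := if unpickle n is Some p then
  (if `[< nbhs 0 (differences (C p)) >] then set0 else C p) else set0.
have [cB nB] : (forall n, closed (B n)) /\ forall n, ~ nbhs 0 (differences (B n)).
  split=> n; rewrite /B; case: unpickle => [p|];
    try (by exact: closed0); try (by exact: thin0).
    by case: ifPn => // _; exact: closed0.
  by case: ifPn => [//|/asboolPn].
exists (\bigcap_n ~` B n); split.
- exists (fun n => ~` B n) => // n; split; first by rewrite openC.
  exact: dense_differences.
- move=> mu muG; rewrite -setC_bigcup setCK; apply: negligible_bigcup => n.
  apply/negligibleP; first exact: borel_closed.
  exact: haar_null_differences.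
move=> g Ag; apply: contrapT => nmin.
have [H [cH sH HT HW]] := return_times_near_subgroup x0 mT nmin.
have [q [eq qH [c c0 qc]]] := escape_norm_subgroup cH sH HT.
(* Points within [2 * r j] of [H] satisfy [q <= 8^-1]. *)
pose j := Num.truncn (16 * c).
have jc : c * (2 * r j) <= 8^-1.
  have h : 16 * c < j.+1%:R by exact: truncnS_gt.
  rewrite /r mulrCA mulrA ler_pdivrMr ?ltr0n //; lra.
pose m := [seq l <- iota 0 (size (net j)) |
  `[< exists2 h, H h & nu (h - nth 0 (net j) l) < r j >]].
pose Wo := \bigcup_(l in [set` m]) [set x | nu (x - nth 0 (net j) l) < r j].
have [V Vx0 HV] : exists2 V, nbhs x0 V & forall n, V (iter n T x0) -> Wo (g *+ n).
  apply: HW; first by apply: bigcup_open => l _; exact: open_norm_ball.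
  move=> h Hh; have [a an ha] := Hnet j h.
  exists (index a (net j)); last by rewrite /= nth_index.
  rewrite /= mem_filter mem_iota /= add0n index_mem an andbT.
  by apply/asboolP; exists h => //; rewrite nth_index.
have [i Ui] : exists i, U i `<=` V.
  have [e e0 eV] := (dN x0 V).1 Vx0; exists (Num.truncn e^-1) => y /= yi.
  apply: eV; apply: lt_trans yi _; rewrite /r invf_plt ?posrE ?ltr0n //.
  exact: truncnS_gt.
pose p := (i, j, m).
have Cpg : C p g.
  move=> n /= Un; have [l lm gl] := HV n (Ui _ Un).
  by exists l => //; exact: ltW.
have nC : ~ nbhs 0 (differences (C p)).
  apply: (small_multiples_differences (q := q) (N := [set n | U i (iter n T x0)])) => //.
  - by exists c.
  - exact: (minimal_return cT mT (Ux0 i)).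
  move=> h n Ch Nn; have [l /=] := Ch n Nn.
  rewrite mem_filter => /andP[/asboolP[h' Hh' h'l] _] gl.
  have [_ qD _ _ _] := eq.
  have := qD (h *+ n - h') h'; rewrite subrK (qH h' Hh') addr0 => /le_trans; apply.
  apply: le_trans (qc _) _; apply: le_trans jc; rewrite ler_pM2l //.
  apply: le_trans (norm_triangle (nth 0 (net j) l) _ _) _.
  by rewrite (norm_dist _ h') mulr_natl mulr2n lerD // ltW.
have := Ag (pickle p) I; rewrite /B pickleK; case: asboolP => //= _; exact.
Qed.

End CompactMetrizableGroup.

Theorem theorem17 (R : realType) (G : topologicalZmodType)
    (G_metrizable : metrizable R G) (G_compact : compact [set: G])
    (G_connected : connected [set: G]) :
  (forall (X : topologicalType) (T : X -> X), minimal_system R T ->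
     exists A : set G,
       [/\ residual A, full_haar_measure R A
         & forall g, A g -> minimal (prod_fun T (rotation g))]) /\
  homeo_product_minimal R G.
Proof.
have [nu nuG] := metrizable_group_norm G_compact G_metrizable.
have main (X : topologicalType) (T : X -> X) : minimal_system R T ->
    exists A : set G, [/\ Gdelta_dense A, full_haar_measure R A
      & forall g, A g -> minimal (prod_fun T (rotation g))].
  move=> XT; have [[x0 _]|nX] := pselect (exists x0 : X, True).
    exact: (rotation_minimal_generic G_compact nuG x0).
  exists [set: G]; split=> [|mu _|g _ M _ [[x h] _]]; last by case: nX; exists x.
    exists (fun=> [set: G]); last by rewrite bigcap_const.
    by move=> _; split; [exact: openT|move=> V V0 _; rewrite setIT].
  by rewrite setCT; exact: negligible_set0.
split=> [X T /main[A [dA mA HA]]|].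
  by exists A; split=> //; exists A.
split=> // X T /main[A [dA _ HA]].
have [g Ag] := Gdelta_dense_neq0 G_compact nuG dA.
exists (rotation g); last exact: HA.
have cont h : continuous (rotation h : G -> G).
  move=> x V; rewrite /rotation addrC => /near_addl.
  by apply: filterS => y; rewrite /= addrC.
split; first exact: cont.
exists (rotation (- g)); split; first exact: cont.
  by move=> x; rewrite /rotation addKr.
by move=> x; rewrite /rotation addNKr.
Qed.
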